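(* Let $V$ be a $C_2$-cofinite vertex operator superalgebra, and let $g,h$ be commuting automorphisms of finite orders $T,T_1$. Then every formal $(g,h)$ 1-point function $S$ converges. More precisely, for each $v$, $S(v,q)$ with $q=e^{2\pi i\tau}$ converges to a holomorphic function on $\mathfrak h$, and the assignment $S(v,\tau):=S(v,e^{2\pi i\tau})$ defines an element of $\mathcal C(g,h)$.
   Context: A vertex operator superalgebra (VOSA) $V=V_{\bar0}\oplus V_{\bar1}$ has the following structure. - Vertex operators $Y(v,z)=\sum v(n)z^{-n-1}$, vacuum $\mathbf1$, and conformal vector $\omega$ (central charge $c$). - The super Jacobi identity holds with sign $(-1)^{\tilde u\tilde v}$. - $V=\bigoplus_{n\in\frac12\mathbb Z}V_n$ by $L(0)$-weight, with $V_{\bar0}$ integral and $V_{\bar1}$ half-integral weights. $\sigma$ is the parity automorphism, and $\epsilon_v=(-1)^{\tilde v}$. $C_2$-cofinite means $\mathrm{span}\{u(-2)v\}$ has finite codimension. $Y[v,z]=Y(v,e^z-1)e^{z\,\mathrm{wt}v}=\sum v[n]z^{-n-1}$; $\tilde\omega=\omega-\frac c{24}\mathbf1$; $Y[\tilde\omega,z]=\sum L[n]z^{-n-2}$; $V_{[k]}$ is the $L[0]$-eigenspace of eigenvalue $k$. $E_{2k}(\tau)=-\frac{B_{2k}(0)}{(2k)!}+\frac2{(2k-1)!}\sum_{n\ge1}\sigma_{2k-1}(n)q^n$, with $B_r$ the Bernoulli polynomials. For $\mu=e^{2\pi ij/M}$ ($0\le j<M$) and a root of unity $\lambda$ with $(\mu,\lambda)\ne(1,1)$: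 $Q_0=-1$, and for $k\ge1$ $Q_k(\mu,\lambda,\tau)=\frac1{(k-1)!}\sum_{n\ge0}\frac{\lambda(n+j/M)^{k-1}q^{n+j/M}}{1-\lambda q^{n+j/M}}+\frac{(-1)^k}{(k-1)!}\sum_{n\ge1}\frac{\lambda^{-1}(n-j/M)^{k-1}q^{n-j/M}}{1-\lambda^{-1}q^{n-j/M}}-\frac{B_k(j/M)}{k!}$. With $N=\mathrm{lcm}(T,T_1)$: $\Gamma(T,T_1)=\{\begin{pmatrix}a&b\\c&d\end{pmatrix}:a\equiv d\equiv1\ (N),b\equiv0\ (T),c\equiv0\ (T_1)\}$; $M(T,T_1)$ is the ring of holomorphic modular forms on $\Gamma(T,T_1)$; $V(T,T_1)=M(T,T_1)\otimes V$. $O(g,h)$ is the $M(T,T_1)$-submodule spanned, for $\mathbb Z_2$-homogeneous $v$ with $gv=\mu^{-1}v$, $hv=\lambda^{-1}v$ and any $w$, by: - $v[0]w$ and $v[-2]w+\sum_{k\ge2}(2k-1)E_{2k}\otimes v[2k-2]w$ when $(\mu,\lambda)=(1,1)$; - $v$ when $(\epsilon_v,\mu,\lambda)\ne(1,1,1)$; - $\sum_{k\ge0}Q_k(\mu,\lambda,\tau)\otimes v[k-1]w$ when $(\mu,\lambda)\ne(1,1)$. $\mathcal C(g,h)$ is the space of $S:V(T,T_1)\times\mathfrak h\to\mathbb C$ that are holomorphic in $\tau$, $M(T,T_1)$-linear in $v$, vanish on $O(g,h)$, and satisfy $S(L[-2]v,\tau)=\partial S(v,\tau)+\sum_{l\ge2}E_{2l}(\tau)S(L[2l-2]v,\tau)$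 for $v$ fixed by $\sigma,g,h$, where $\partial S(v,\tau)=\frac1{2\pi i}\frac d{d\tau}S(v,\tau)+kE_2(\tau)S(v,\tau)$ for $v\in V_{[k]}$. A formal $(g,h)$ 1-point function is a map $S$ from $V(T,T_1)$ to the space of formal series $q^\lambda\sum_{n\ge0}a_nq^{n/T}$ ($\lambda\in\mathbb C$) satisfying the same conditions (linearity, vanishing on $O(g,h)$, and the $L[-2]$ identity). In these conditions modular forms and $E_{2k}$ are identified with their $q$-expansions, and $\frac1{2\pi i}\frac d{d\tau}$ is replaced by $q\frac d{dq}$. *)

(* Defs.v *)
(* Complex numbers are mathcomp-real-closed's
   [R[i]] over an arbitrary [R : realType], used through its regular-algebra copy
   [(R[i])^o] so that MathComp-Analysis sees it as a normed module over itself
   (this gives complex differentiability, limits of complex series, ...). *)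
From HB Require Import structures.
From mathcomp Require Import all_boot all_order all_algebra.
From mathcomp Require Import complex.
From mathcomp Require Import all_classical all_reals all_analysis.
From Stdlib Require Import ClassicalEpsilon.
Set Implicit Arguments. Unset Strict Implicit. Unset Printing Implicit Defensive.
Import Order.TTheory GRing.Theory Num.Theory.
Import ComplexField.
Import numFieldNormedType.Exports.
Local Open Scope classical_set_scope.
Local Open Scope ring_scope.

Notation CC R := ((R[i])^o).

Section Defs.
Variable R : realType.
Local Notation C := (CC R).

Definition cRe (z : C) : R := complex.Re z.
Definition cIm (z : C) : R := complex.Im z.
Definition cmk (x y : R) : C := (x +i* y)%C.
Definition cexp (z : C) : C :=
  cmk (expR (cRe z) * cos (cIm z)) (expR (cRe z) * sin (cIm z)).
Definition twopii : C := cmk 0 (2 * pi).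
Definition qpow (x tau : C) : C := cexp (twopii * x * tau).
Definition csum (u : nat -> C) : C := lim (series u @ \oo).

(* Bernoulli polynomials B_n(x) (explicit formula, B_1(x) = x - 1/2) *)
Definition bernp (n : nat) (x : C) : C :=
  \sum_(k < n.+1) (k.+1)%:R^-1 *
     \sum_(j < k.+1) ((-1) ^+ j * 'C(k, j)%:R * (x + j%:R) ^+ n).

Definition sigmaf (k n : nat) : C := \sum_(d < n.+1 | (d %| n)%N) (d%:R : C) ^+ k.

Definition ecoef (k n : nat) : C :=
  if n == 0%N then - bernp (2 * k) 0 / ((2 * k)`!)%:R
  else 2 / (((2 * k).-1)`!)%:R * sigmaf (2 * k).-1 n.
Definition Efun (k : nat) (tau : C) : C := csum (fun n => ecoef k n * qpow n%:R tau).

Definition rootT (T j : nat) : C := cexp (twopii * j%:R / T%:R).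

Definition Qfun (T j : nat) (lam : C) (k : nat) (tau : C) : C :=
  if k is k'.+1 then
    (k'`!)%:R^-1 * csum (fun n => let x := n%:R + j%:R / T%:R in
                        lam * x ^+ k' * qpow x tau / (1 - lam * qpow x tau))
  + (-1) ^+ k / (k'`!)%:R * csum (fun n => let y := n.+1%:R - j%:R / T%:R in
                        lam^-1 * y ^+ k' * qpow y tau / (1 - lam^-1 * qpow y tau))
  - bernp k (j%:R / T%:R) / (k`!)%:R
  else -1.

(* Formal series q^lam sum_n a_n q^{n/T}: coefficient functions C -> C *)
(* (exponent |-> coefficient)                                          *)
Definition fser := C -> C.
Definition fadm (T : nat) (a : fser) : Prop :=
  exists lam : C, forall mu : C, a mu != 0 -> exists n : nat, mu = lam + n%:R / T%:R.
(* product with a series sum_r b_r q^{r/T} (a finite sum on admissible a) *)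
Definition fmul (T : nat) (b : nat -> C) (a : fser) : fser :=
  fun mu => csum (fun r => b r * a (mu - r%:R / T%:R)).
Definition fder (a : fser) : fser := fun mu => mu * a mu.
Definition ecoefT (T k r : nat) : C := if (T %| r)%N then ecoef k (r %/ T) else 0.
(* q-expansion of Q_k(mu_j, lam, tau) as a series in q^{1/T}: coefficient of q^{r/T} *)
Definition Qcoef (T j : nat) (lam : C) (k r : nat) : C :=
  if k is k'.+1 then
    (k'`!)%:R^-1 *
      (\sum_(m < r.+1) \sum_(n < r.+1)
          (if [&& (0 < m)%N, (0 < r)%N & (m * (n * T + j) == r)%N]
           then lam ^+ m * (n%:R + j%:R / T%:R) ^+ k' else 0)
       + (if (r == 0%N) && (j == 0%N) then lam * 0 ^+ k' / (1 - lam) else 0))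
  + (-1) ^+ k / (k'`!)%:R *
      \sum_(m < r.+1) \sum_(n < r.+1)
          (if [&& (0 < m)%N, (0 < n)%N & (m * (n * T - j) == r)%N]
           then lam ^- m * (n%:R - j%:R / T%:R) ^+ k' else 0)
  - (r == 0%N)%:R * bernp k (j%:R / T%:R) / (k`!)%:R
  else - (r == 0%N)%:R.

Definition ps_one : nat -> C := fun k => (k == 0%N)%:R.
Definition ps_mul (a b : nat -> C) : nat -> C :=
  fun k => \sum_(i < k.+1) a i * b (k - i)%N.
Definition gbin (s : int) (j : nat) : C := (\prod_(i < j) (s%:~R - i%:R)) / (j`!)%:R.
(* (e^z - 1)/z - 1 *)
Definition ezm1 : nat -> C := fun k => if k == 0%N then 0 else ((k.+1)`!)%:R^-1.
(* ((e^z - 1)/z)^s, s integer *)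
Definition ps_pow_int (s : int) : nat -> C :=
  fun d => \sum_(j < d.+1) gbin s j * iter j (ps_mul ezm1) ps_one d.
Definition ps_exp (a : C) : nat -> C := fun k => a ^+ k / (k`!)%:R.
(* coefficient of v(m) in v[n] for v of weight a (m >= n):
   the coefficient of z^{-n-1} in (e^z - 1)^{-m-1} e^{z a} *)
Definition zcoef (a : C) (m n : int) : C :=
  ps_mul (ps_pow_int (- m - 1)) (ps_exp a) `|m - n|%N.

Variable V : lmodType C.
(* Y u n = the mode u(n), Y(u,z) = sum_n u(n) z^{-n-1} *)
Variables (Y : V -> int -> V -> V) (vac om : V) (c : C) (sig : V -> V).

Definition par (v : V) (b : bool) : Prop := sig v = (-1) ^+ b *: v.
Definition L0 (v : V) : V := Y om 1 v.

Record is_vosa : Prop := IsVosa {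
  Y_linl : forall n w (a : C) u1 u2, Y (a *: u1 + u2) n w = a *: Y u1 n w + Y u2 n w;
  Y_linr : forall u n (a : C) w1 w2, Y u n (a *: w1 + w2) = a *: Y u n w1 + Y u n w2;
  sig_lin : forall (a : C) u w, sig (a *: u + w) = a *: sig u + sig w;
  sig_inv : forall v, sig (sig v) = v;
  sig_Y : forall u n w, sig (Y u n w) = Y (sig u) n (sig w);
  Y_trunc : forall u w, exists N : int, forall n : int, N <= n -> Y u n w = 0;
  Y_vac : forall n w, Y vac n w = if n == -1 then w else 0;
  Y_creat : forall u, Y u (-1) vac = u /\ (forall n : int, 0 <= n -> Y u n vac = 0);
  (* super Jacobi identity, in components (Borcherds identity) *)
  Y_jacobi : forall u v (bu bv : bool), par u bu -> par v bv ->
    forall (p q r : int) w, exists N : nat, forall K : nat, (N <= K)%N ->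
      \sum_(i < K) gbin p i *: Y (Y u (r + i%:Z) v) (p + q - i%:Z) w =
      \sum_(i < K) ((-1) ^+ i * gbin r i) *:
          (Y u (p + r - i%:Z) (Y v (q + i%:Z) w)
           - ((-1) ^+ `|r|%N * (-1) ^+ (bu && bv)) *: Y v (q + r - i%:Z) (Y u (p + i%:Z) w));
  (* conformal vector: L(n) = om(n+1) *)
  Y_vir : forall (m n : int) w,
    Y om (m + 1) (Y om (n + 1) w) - Y om (n + 1) (Y om (m + 1) w) =
      (m - n)%:~R *: Y om (m + n + 1) w
      + (if m + n == 0 then ((m ^+ 3 - m)%:~R / 12%:R * c) else 0) *: w;
  Y_deriv : forall u (n : int) w, Y (Y om 0 u) n w = (- n%:~R) *: Y u (n - 1) w;
  L0_decomp : forall v, exists s : seq (int * V),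
      v = \sum_(x <- s) x.2 /\ (forall x, x \in s -> L0 x.2 = (x.1%:~R / 2%:R) *: x.2);
  L0_parity : forall (n : int) v, L0 v = (n%:~R / 2%:R) *: v -> par v (odd `|n|%N);
  L0_findim : forall n : int, exists s : seq V, forall v, L0 v = (n%:~R / 2%:R) *: v ->
      exists a : nat -> C, v = \sum_(i < size s) a i *: nth 0 s i;
  L0_bounded : exists n0 : int, forall (n : int) v, n < n0 -> L0 v = (n%:~R / 2%:R) *: v -> v = 0;
  om_wt : L0 om = 2%:R *: om
}.

Definition C2_cofinite : Prop :=
  exists s : seq V, forall x : V, exists (a : nat -> C) (t : seq (V * V)),
    x = \sum_(i < size s) a i *: nth 0 s i + \sum_(p <- t) Y p.1 (-2) p.2.

Definition is_aut (g : V -> V) : Prop :=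
  [/\ forall (a : C) u w, g (a *: u + w) = a *: g u + g w,
      bijective g,
      forall u n w, g (Y u n w) = Y (g u) n (g w),
      g vac = vac & g om = om].

Definition has_order (g : V -> V) (T : nat) : Prop :=
  [/\ (0 < T)%N, forall v, iter T g v = v &
      forall k : nat, (0 < k)%N -> (k < T)%N -> ~ (forall v, iter k g v = v)].

(* Zhu's modes: v[n] for v of L(0)-weight a; Y[v,z] = Y(v, e^z - 1) e^{z a} *)
Definition trunc_bound (u w : V) : int :=
  epsilon (inhabits (0 : int)) (fun N : int => forall n : int, N <= n -> Y u n w = 0).
Definition zhu (u : V) (a : C) (n : int) (w : V) : V :=
  \sum_(i < `|trunc_bound u w - n|%N) zcoef a (n + i%:Z) n *: Y u (n + i%:Z) w.
(* L[n], Y[om - c/24, z] = sum L[n] z^{-n-2} *)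
Definition Lb (n : int) (w : V) : V :=
  zhu om 2%:R (n + 1) w - (if n == -2 then c / 24%:R else 0) *: w.

Definition eigen (g h : V -> V) (T T1 : nat) (v : V) (a : C) (b : bool) (j : nat) (lam : C) :=
  [/\ L0 v = a *: v, par v b, (j < T)%N, g v = (rootT T j)^-1 *: v
    & lam ^+ T1 = 1 /\ h v = lam^-1 *: v].

(* the space C(g,h), with S(f (x) v, tau) = f(tau) S(v, tau) (M(T,T1)-linearity) *)
Record in_Cgh (g h : V -> V) (T T1 : nat) (F : V -> C -> C) : Prop := InCgh {
  Cgh_holo : forall v tau, 0 < cIm tau -> derivable (F v) tau 1;
  Cgh_lin : forall (a : C) u w tau, 0 < cIm tau -> F (a *: u + w) tau = a * F u tau + F w tau;
  Cgh_O1 : forall v a b w tau, 0 < cIm tau -> eigen g h T T1 v a b 0 1 ->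
        F (zhu v a 0 w) tau = 0 /\
        (forall K : nat, (forall n : nat, (K <= n)%N -> zhu v a n%:Z w = 0) ->
           F (zhu v a (-2) w) tau
           + \sum_(2 <= k < K) ((2 * k).-1%:R * Efun k tau * F (zhu v a ((2 * k).-2)%:Z w) tau) = 0);
  Cgh_O2 : forall v a b j lam tau, 0 < cIm tau -> eigen g h T T1 v a b j lam ->
        ~ (b = false /\ j = 0%N /\ lam = 1) -> F v tau = 0;
  Cgh_O3 : forall v a b j lam w tau, 0 < cIm tau -> eigen g h T T1 v a b j lam ->
        ~ (j = 0%N /\ lam = 1) ->
        forall K : nat, (forall n : nat, (K <= n)%N -> zhu v a n%:Z w = 0) ->
          \sum_(k < K.+1) Qfun T j lam k tau * F (zhu v a (k%:Z - 1) w) tau = 0;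
  Cgh_L : forall v (k : C) tau, 0 < cIm tau -> sig v = v -> g v = v -> h v = v -> Lb 0 v = k *: v ->
        forall K : nat, (forall l : nat, (2 <= l)%N -> (K <= l)%N -> Lb ((2 * l).-2)%:Z v = 0) ->
          F (Lb (-2) v) tau =
            twopii^-1 * derive1 (F v) tau + k * Efun 1 tau * F v tau
            + \sum_(2 <= l < K) Efun l tau * F (Lb ((2 * l).-2)%:Z v) tau }.

Record formal_1pt (g h : V -> V) (T T1 : nat) (S : V -> fser) : Prop := Formal1pt {
  f_adm : forall v, fadm T (S v);
  f_lin : forall (a : C) u w mu, S (a *: u + w) mu = a * S u mu + S w mu;
  f_O1 : forall v a b w, eigen g h T T1 v a b 0 1 ->
        (forall mu, S (zhu v a 0 w) mu = 0) /\
        (forall K : nat, (forall n : nat, (K <= n)%N -> zhu v a n%:Z w = 0) -> forall mu,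
           S (zhu v a (-2) w) mu
           + \sum_(2 <= k < K) ((2 * k).-1%:R * fmul T (ecoefT T k) (S (zhu v a ((2 * k).-2)%:Z w)) mu) = 0);
  f_O2 : forall v a b j lam, eigen g h T T1 v a b j lam ->
        ~ (b = false /\ j = 0%N /\ lam = 1) -> forall mu, S v mu = 0;
  f_O3 : forall v a b j lam w, eigen g h T T1 v a b j lam ->
        ~ (j = 0%N /\ lam = 1) ->
        forall K : nat, (forall n : nat, (K <= n)%N -> zhu v a n%:Z w = 0) -> forall mu,
          \sum_(k < K.+1) fmul T (Qcoef T j lam k) (S (zhu v a (k%:Z - 1) w)) mu = 0;
  f_L : forall v (k : C), sig v = v -> g v = v -> h v = v -> Lb 0 v = k *: v ->
        forall K : nat, (forall l : nat, (2 <= l)%N -> (K <= l)%N -> Lb ((2 * l).-2)%:Z v = 0) ->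
        forall mu,
          S (Lb (-2) v) mu =
            fder (S v) mu + k * fmul T (ecoefT T 1) (S v) mu
            + \sum_(2 <= l < K) fmul T (ecoefT T l) (S (Lb ((2 * l).-2)%:Z v)) mu }.

End Defs.

(* Main.v *)
Require Import Defs.
From HB Require Import structures.
From mathcomp Require Import all_boot all_order all_algebra.
From mathcomp Require Import complex.
From mathcomp Require Import all_classical all_reals all_analysis.
From mathcomp Require Import ring lra zify.
Import Order.TTheory GRing.Theory Num.Theory.
Import ComplexField.
Import numFieldNormedType.Exports.
Local Open Scope classical_set_scope.
Local Open Scope ring_scope.
Set Implicit Arguments.
Unset Strict Implicit.
Unset Printing Implicit Defensive.

(* The coefficients E_{2k} and Q_k have q-expansions in q^{1/T} that converge on the whole
   unit disc. By C_2-cofiniteness and induction on the L(0)-weight, every S(v) is a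
   combination of finitely many S(b_i) with coefficients in the ring A of power series in
   q^{1/T} converging on the unit disc. Since L[0] is triangular with respect to the weight
   filtration, the L[-2] identity applies to all v and gives a first-order system
   q d/dq S(b_i) = sum_j f_ij S(b_j) with f_ij in A. Its formal solutions converge on the whole
   disc: the coefficient at exponent lam + n/T is obtained by dividing by a quantity of size
   n/T, so it grows subexponentially. Evaluation is then compatible with sums, products by A
   and q d/dq, which transfers all the formal identities. *)

(** The coefficients are taken in A rather than in the ring of modular forms because the L[-2]
    identity brings in E_2, which is not modular; membership in A is purely a growth condition. The
    differential system has a regular singular point at q = 0 with an arbitrary matrix there, so for
    small n the divisor may vanish. This is harmless: the formal solution is given, only its growth
    is in question, and the finitely many initial coefficients are absorbed into a constant. The
    L[-2] identity is assumed for fixed vectors only; on eigenvectors with a nontrivial sigma-, g-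
    or h-eigenvalue S vanishes by the relations. A formal series is a function of the exponent. The
    base lam of its support is not unique and not a priori the same for different v. Two bases of a
    nonzero series differ by an element of Z/T and yield the same value, and a common base for
    finitely many vectors is extracted from linearity; only then can a formal identity be evaluated
    term by term. *)

(** * Real-valued modulus and convergence of complex sequences *)

Section ComplexModulus.
Variable R : realType.
Local Notation C := (CC R).

(** The norm of [R[i]] takes values in [R[i]], which is only partially ordered. [cabs] is the same
    number in the totally ordered field [R], where all estimates take place. *)
Definition cabs (z : C) : R := complex.Re (`|z : R[i]|).

Lemma cabsE (z : C) : (cabs z)%:C%C = `|z : R[i]|.
Proof. by rewrite /cabs normc_def. Qed.

Lemma cabs_ge0 z : 0 <= cabs z.
Proof. by rewrite -ler0c cabsE. Qed.

Lemma cabs0 : cabs 0 = 0. Proof. by rewrite /cabs normr0. Qed.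
Lemma cabs1 : cabs 1 = 1. Proof. by rewrite /cabs normr1. Qed.
Lemma cabsN z : cabs (- z) = cabs z. Proof. by rewrite /cabs normrN. Qed.
Lemma cabsB z w : cabs (z - w) = cabs (w - z). Proof. by rewrite -cabsN opprB. Qed.

Lemma cabsM (z w : C) : cabs (z * w) = cabs z * cabs w.
Proof.
apply: (@complexI R); rewrite cabsE rmorphM /= !cabsE; exact: normrM.
Qed.

Lemma cabsV (z : C) : cabs z^-1 = (cabs z)^-1.
Proof. apply: (@complexI R); rewrite cabsE fmorphV /= cabsE; exact: normfV. Qed.

Lemma cabsX (z : C) n : cabs (z ^+ n) = cabs z ^+ n.
Proof. by elim: n => [|n IH]; rewrite ?expr0 ?cabs1 // !exprS cabsM IH. Qed.

Lemma cabsD (z w : C) : cabs (z + w) <= cabs z + cabs w.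
Proof. rewrite -lecR rmorphD /= !cabsE; exact: ler_normD. Qed.

Lemma cabs_eq0 (z : C) : (cabs z == 0) = (z == 0).
Proof. by rewrite -(inj_eq (@complexI R)) cabsE /= normr_eq0. Qed.

Lemma cabs_nat n : cabs n%:R = n%:R.
Proof. apply: (@complexI R); rewrite cabsE rmorph_nat; exact: normr_nat. Qed.

Lemma cabs_sum (I : Type) (s : seq I) (P : pred I) (F : I -> C) :
  cabs (\sum_(i <- s | P i) F i) <= \sum_(i <- s | P i) cabs (F i).
Proof.
elim/big_rec2: _ => [|i y x _ IH]; first by rewrite cabs0.
by apply: le_trans (cabsD _ _) _; rewrite lerD2l.
Qed.

Lemma cabs_leD (z w : C) : cabs z - cabs w <= cabs (z + w).
Proof.
rewrite lerBlDr; have {1}-> : z = (z + w) + - w by rewrite addrK.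
by apply: le_trans (cabsD _ _) _; rewrite cabsN.
Qed.

Lemma cabs_geRe (z : C) : `|cRe z| <= cabs z.
Proof. by rewrite -lecR cabsE; exact: normc_ge_Re. Qed.

Lemma cabs_leReIm (z : C) : cabs z <= `|cRe z| + `|cIm z|.
Proof.
case: z => x y; rewrite /cabs normc_def /= -[leRHS]ger0_norm ?addr_ge0 //.
rewrite -sqrtr_sqr ler_sqrt ?sqr_ge0 // sqrrD !real_normK ?num_real //.
by rewrite -addrA lerD2l lerDr mulrn_wge0 // mulr_ge0.
Qed.

Lemma cabs_geIm (z : C) : `|cIm z| <= cabs z.
Proof.
case: z => x y; rewrite /cabs normc_def /= -sqrtr_sqr ler_sqrt.
  by rewrite lerDr sqr_ge0.
by rewrite addr_ge0 ?sqr_ge0.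
Qed.

Lemma cmkE (z : C) : z = cmk (cRe z) (cIm z). Proof. by case: z. Qed.
Lemma cReD (z w : C) : cRe (z + w) = cRe z + cRe w. Proof. by case: z w => [? ?] [? ?]. Qed.
Lemma cImD (z w : C) : cIm (z + w) = cIm z + cIm w. Proof. by case: z w => [? ?] [? ?]. Qed.
Lemma cReN (z : C) : cRe (- z) = - cRe z. Proof. by case: z. Qed.
Lemma cImN (z : C) : cIm (- z) = - cIm z. Proof. by case: z. Qed.
Lemma cReM (z w : C) : cRe (z * w) = cRe z * cRe w - cIm z * cIm w. Proof. by case: z w => [? ?] [? ?]. Qed.
Lemma cImM (z w : C) : cIm (z * w) = cRe z * cIm w + cIm z * cRe w. Proof. by case: z w => [? ?] [? ?]. Qed.

Lemma ccvgP (u : nat -> C) (l : C) :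
  u @ \oo --> l <-> (fun n => cabs (u n - l)) @ \oo --> (0 : R).
Proof.
split=> [/cvgrPdist_lt H | /cvgrPdist_lt H]; apply/cvgrPdist_lt => e e0.
  have e0' : 0 < e%:C%C by rewrite ltcR.
  near=> n; have : `|l - u n| < e%:C%C by near: n; exact: H.
  rewrite -cabsE ltcR sub0r normrN ger0_norm ?cabs_ge0 //.
  by rewrite cabsB.
(* A positive element of [R[i]] has zero imaginary part, so it is a positive real. *)
have [r r0 er] : exists2 r : R, 0 < r & e = r%:C%C.
  exists (complex.Re e).
    by move: e0; rewrite ltcE => /andP[].
  by move: e0; case: e => a b; rewrite ltcE /= => /andP[/eqP -> _].
near=> n; have : `|0 - cabs (u n - l)| < r by near: n; exact: H.
by rewrite sub0r normrN ger0_norm ?cabs_ge0 // er -ltcR cabsE distrC.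
Unshelve. all: by end_near.
Qed.

Lemma ccvg_le (u : nat -> C) (l : C) (e : nat -> R) :
  e @ \oo --> (0 : R) -> (forall n, cabs (u n - l) <= e n) -> u @ \oo --> l.
Proof.
move=> e0 H; apply/ccvgP; apply: (squeeze_cvgr _ (cvg_cst (0 : R)) e0).
by near=> n; rewrite cabs_ge0 H.
Unshelve. all: by end_near.
Qed.

Lemma ccvg_lim (u : nat -> C) (l : C) : u @ \oo --> l -> lim (u @ \oo) = l.
Proof. by move=> H; apply: cvg_lim H; exact: norm_hausdorff. Qed.

Lemma ccvg_ReIm (u : nat -> C) (a b : R) :
  (@cRe R \o u) @ \oo --> a -> (@cIm R \o u) @ \oo --> b -> u @ \oo --> (cmk a b : C).
Proof.
move=> Ha Hb; apply: (@ccvg_le _ _ (fun n => `|cRe (u n) - a| + `|cIm (u n) - b|)).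
  have N (v : nat -> R) l : v @ \oo --> l -> (fun n => `|v n - l|) @ \oo --> (0 : R).
    by move=> h; rewrite -(@normr0 _ R) -(subrr l); apply: cvg_norm; apply: cvgB; [|exact: cvg_cst].
  by rewrite -[X in _ --> X](addr0 (0 : R)); apply: cvgD; apply: N.
move=> n; apply: le_trans (cabs_leReIm _) _.
by rewrite cReD cImD cReN cImN.
Qed.

Lemma cRe_series (u : nat -> C) n : cRe (series u n) = series (@cRe R \o u) n.
Proof. by rewrite !seriesEnat /=; elim/big_rec2: _ => //= i y x _ <-; rewrite cReD. Qed.
Lemma cIm_series (u : nat -> C) n : cIm (series u n) = series (@cIm R \o u) n.
Proof. by rewrite !seriesEnat /=; elim/big_rec2: _ => //= i y x _ <-; rewrite cImD. Qed.

Lemma bounded_series_cvg (u : nat -> R) (M : R) :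
  (forall n, 0 <= u n) -> (forall n, series u n <= M) -> cvgn (series u).
Proof.
move=> u0 uM; apply: nondecreasing_is_cvgn; first exact: nondecreasing_series.
by exists M => _ [n _ <-].
Qed.

(** Real and imaginary parts are dominated by [cabs], so each of the two real series converges
    absolutely. *)
Lemma abs_series_cvg (u : nat -> C) (M : R) :
  (forall n, \sum_(i < n) cabs (u i) <= M) -> exists l : C, series u @ \oo --> l.
Proof.
move=> H.
have key (v : nat -> R) : (forall n, `|v n| <= cabs (u n)) -> cvgn (series v).
  move=> Hv; apply: normed_cvg; apply: (@bounded_series_cvg _ M) => n; first exact: normr_ge0.
  apply: le_trans _ (H n); rewrite seriesEnat /= big_mkord; exact: ler_sum.
have /cvg_ex[a Ha] := key _ (fun n => cabs_geRe (u n)).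
have /cvg_ex[b Hb] := key _ (fun n => cabs_geIm (u n)).
exists (cmk a b); apply: ccvg_ReIm.
  by move: Ha; apply: cvg_trans; apply: near_eq_cvg; near=> n; rewrite /= cRe_series.
by move: Hb; apply: cvg_trans; apply: near_eq_cvg; near=> n; rewrite /= cIm_series.
Unshelve. all: by end_near.
Qed.

End ComplexModulus.

(** * Rearrangement of finite double sums *)

Section SumManipulation.
Variable A : nmodType.

Lemma triangular_sum (G : nat -> nat -> A) K :
  \sum_(n < K) \sum_(i < n.+1) G i (n - i)%N = \sum_(i < K) \sum_(j < K - i) G i j.
Proof.
elim: K => [|K IH]; first by rewrite !big_ord0.
rewrite big_ord_recr /= IH [RHS]big_ord_recr /= subSnn big_ord1.
rewrite [X in _ + X = _]big_ord_recr /= subnn addrA; congr (_ + _).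
rewrite -big_split /=; apply: eq_bigr => i _.
by rewrite subSn ?(ltnW (ltn_ord i)) // big_ord_recr.
Qed.

(** Cuts a square along its antidiagonal: the lower triangle is a partial sum of the Cauchy product,
    the upper one is the error to be estimated. *)
Lemma square_sum (G : nat -> nat -> A) K :
  \sum_(i < K) \sum_(j < K) G i j =
    \sum_(n < K) \sum_(i < n.+1) G i (n - i)%N + \sum_(i < K) \sum_(K - i <= j < K) G i j.
Proof.
rewrite triangular_sum -big_split /=; apply: eq_bigr => i _.
by rewrite -!(big_mkord xpredT (G i)) /= -big_cat_nat //= leq_subr.
Qed.

End SumManipulation.

(** * Sequences whose generating series converges on the open unit disc *)

Section Subexponential.
Variable R : realType.
Local Notation C := (CC R).

(** For nonnegative [f] this says that the series with coefficients [f n] has radius of convergence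
    at least 1. Bounded partial sums at every radius are easier to propagate than a root test. *)
Definition rsubexp (f : nat -> R) :=
  forall r : R, 0 <= r < 1 -> exists M, forall N, \sum_(i < N) f i * r ^+ i <= M.

Lemma rsubexp_le f g : (forall n, f n <= g n) -> rsubexp g -> rsubexp f.
Proof.
move=> fg Hg r r01; have [M HM] := Hg r r01; exists M => N.
apply: le_trans (HM N); apply: ler_sum => i _; apply: ler_wpM2r => //.
by apply: exprn_ge0; case/andP: r01.
Qed.

Lemma rsubexpD f g : rsubexp f -> rsubexp g -> rsubexp (fun n => f n + g n).
Proof.
move=> Hf Hg r r01; have [M HM] := Hf r r01; have [M' HM'] := Hg r r01.
exists (M + M') => N; under eq_bigr do rewrite mulrDl.
by rewrite big_split lerD.
Qed.

Lemma rsubexpZ c f : 0 <= c -> rsubexp f -> rsubexp (fun n => c * f n).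
Proof.
move=> c0 Hf r r01; have [M HM] := Hf r r01.
exists (c * M) => N; under eq_bigr do rewrite -mulrA.
by rewrite -mulr_sumr ler_wpM2l.
Qed.

Lemma geometric_le (r : R) N : 0 <= r < 1 -> \sum_(i < N) r ^+ i <= (1 - r)^-1.
Proof.
move=> /andP[r0 r1]; rewrite -[leRHS]mul1r ler_pdivlMr ?subr_gt0 //.
have -> : (\sum_(i < N) r ^+ i) * (1 - r) = 1 - r ^+ N.
  elim: N => [|N IH]; first by rewrite big_ord0; ring.
  rewrite big_ord_recr /= mulrDl IH exprS; ring.
by rewrite gerBl exprn_ge0.
Qed.

(** Boundedness of the terms at the larger radius [sqrt r] suffices: since r = s^2, the term f_i r^i
    is (f_i s^i) s^i, dominated by a geometric series. *)
Lemma rsubexp_bounded f :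
  (forall r : R, 0 <= r < 1 -> exists M, forall n, f n * r ^+ n <= M) -> rsubexp f.
Proof.
move=> H r /andP[r0 r1]; pose s := Num.sqrt r.
have s01 : 0 <= s < 1.
  by rewrite sqrtr_ge0 /= -sqrtr1 ltr_sqrt.
have [M HM] := H s s01; have [s0 _] := andP s01.
exists (`|M| * (1 - s)^-1) => N.
apply: le_trans (_ : \sum_(i < N) `|M| * s ^+ i <= _); last first.
  by rewrite -mulr_sumr ler_wpM2l // geometric_le.
apply: ler_sum => i _; rewrite -(sqr_sqrtr r0) -/s -exprM mulnC exprM expr2 mulrA.
by rewrite ler_wpM2r ?exprn_ge0 //; apply: le_trans (HM i) _; exact: ler_norm.
Qed.

Lemma rsubexp_cst c : rsubexp (fun=> c).
Proof.
apply: (@rsubexp_le _ (fun=> `|c| * 1)) => [n|]; first by rewrite mulr1 ler_norm.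
apply: rsubexpZ => //; apply: rsubexp_bounded => r /andP[r0 r1]; exists 1 => n.
by rewrite mul1r exprn_ile1 // ltW.
Qed.

(** The quotient (s^(n+1) - r^(n+1)) / (s - r) is a sum of n+1 terms, each at least r^n. The lemma
    trades a factor n+1 for a slightly larger radius. *)
Lemma mulS_expr_le (r s : R) n : 0 <= r -> r <= s -> s <= 1 ->
  n.+1%:R * r ^+ n * (s - r) <= s ^+ n.
Proof.
move=> r0 rs s1; have s0 := le_trans r0 rs.
suff H : n.+1%:R * r ^+ n * (s - r) <= s ^+ n.+1 - r ^+ n.+1.
  apply: le_trans H _; rewrite lerBlDr exprS.
  by apply: le_trans (ler_piMl _ s1) _; rewrite ?exprn_ge0 // lerDl exprn_ge0.
elim: n => [|n IH]; first by rewrite expr0 !expr1 !mul1r.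
rewrite -natr1 mulrDl mul1r mulrDl.
have -> : s ^+ n.+2 - r ^+ n.+2 = r * (s ^+ n.+1 - r ^+ n.+1) + s ^+ n.+1 * (s - r).
  by rewrite !(exprS _ n.+1); ring.
apply: lerD.
  rewrite {1}[r ^+ n.+1]exprS; have -> : n.+1%:R * (r * r ^+ n) * (s - r) = r * (n.+1%:R * r ^+ n * (s - r)).
    by ring.
  by rewrite ler_wpM2l.
by rewrite ler_wpM2r ?subr_ge0 // lerXn2r // nnegrE.
Qed.

Lemma between1 (r : R) : 0 <= r < 1 -> exists s, [/\ r < s, 0 <= s < 1 & 0 < s].
Proof. by move=> /andP[r0 r1]; exists ((r + 1) / 2); split; lra. Qed.

Lemma rsubexp_mulS f : (forall n, 0 <= f n) -> rsubexp f -> rsubexp (fun n => n.+1%:R * f n).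
Proof.
move=> f0 Hf r r01; have [s [rs s01 s0]] := between1 r01; have [M HM] := Hf s s01.
have [r0 r1] := andP r01; have [_ s1] := andP s01.
exists (M / (s - r)) => N; rewrite ler_pdivlMr ?subr_gt0 //.
apply: le_trans (HM N); rewrite mulr_suml; apply: ler_sum => i _.
have -> : i.+1%:R * f i * r ^+ i * (s - r) = f i * (i.+1%:R * r ^+ i * (s - r)) by ring.
by rewrite ler_wpM2l // mulS_expr_le // ltW.
Qed.

(** The terms of the convolution fill a triangle inside the square whose total is the product of the
    two partial sums. *)
Lemma rsubexp_conv f g : (forall n, 0 <= f n) -> (forall n, 0 <= g n) -> rsubexp f -> rsubexp g ->
  rsubexp (fun n => \sum_(i < n.+1) f i * g (n - i)%N).
Proof.
move=> f0 g0 Hf Hg r r01; have [M HM] := Hf r r01; have [M' HM'] := Hg r r01.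
have [r0 r1] := andP r01.
exists (M * M') => N.
have f0' i : 0 <= f i * r ^+ i by rewrite mulr_ge0 ?exprn_ge0.
have g0' i : 0 <= g i * r ^+ i by rewrite mulr_ge0 ?exprn_ge0.
apply: le_trans (_ : (\sum_(i < N) f i * r ^+ i) * (\sum_(i < N) g i * r ^+ i) <= _); last first.
  by apply: ler_pM => //; apply: sumr_ge0.
rewrite big_distrlr /= (square_sum (fun i j => f i * r ^+ i * (g j * r ^+ j))).
apply: ler_wpDr; first by apply: sumr_ge0 => i _; apply: sumr_ge0 => j _; rewrite mulr_ge0.
apply: ler_sum => n _; rewrite mulr_suml; apply: ler_sum => i _.
have -> : r ^+ n = r ^+ i * r ^+ (n - i) by rewrite -exprD subnKC // -ltnS.
by rewrite mulrACA.
Qed.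

Lemma rsubexp_shift f : (forall n, 0 <= f n) -> rsubexp f -> rsubexp (fun n => f n.+1).
Proof.
move=> f0 Hf r r01; have [s [rs s01 s0]] := between1 r01; have [M HM] := Hf s s01.
exists (M / s) => N; rewrite ler_pdivlMr //; apply: le_trans (HM N.+1).
rewrite big_ord_recl expr0 mulr1 ler_wpDl // mulr_suml; apply: ler_sum => i _ /=.
rewrite -mulrA /bump /= add1n exprSr ler_wpM2l //.
rewrite ler_wpM2r ?(ltW s0) // lerXn2r ?nnegrE ?(ltW rs) ?(ltW s0) //; by case/andP: r01.
Qed.

Definition subexp (a : nat -> C) := rsubexp (fun n => cabs (a n)).

Lemma subexp_le a b : (forall n, cabs (a n) <= cabs (b n)) -> subexp b -> subexp a.
Proof. exact: rsubexp_le. Qed.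

Lemma subexpD a b : subexp a -> subexp b -> subexp (fun n => a n + b n).
Proof.
by move=> Ha Hb; apply: rsubexp_le (rsubexpD Ha Hb) => n; exact: cabsD.
Qed.

Lemma subexpZ c a : subexp a -> subexp (fun n => c * a n).
Proof.
move=> Ha; apply: rsubexp_le (rsubexpZ (cabs_ge0 c) Ha) => n; by rewrite cabsM.
Qed.

Lemma subexpM a b : subexp a -> subexp b -> subexp (ps_mul a b).
Proof.
move=> Ha Hb; apply: rsubexp_le (rsubexp_conv (fun n => cabs_ge0 (a n)) (fun n => cabs_ge0 (b n)) Ha Hb) => n.
rewrite /ps_mul; apply: le_trans (cabs_sum _ _ _) _; apply: ler_sum => i _; by rewrite cabsM.
Qed.

Lemma rsubexp_poly c d : 0 <= c -> rsubexp (fun n => c * n.+1%:R ^+ d).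
Proof.
move=> c0; apply: rsubexpZ => //; elim: d => [|d IH].
  by apply: rsubexp_le (rsubexp_cst 1) => n; rewrite expr0.
by apply: rsubexp_le (rsubexp_mulS _ IH) => n; rewrite ?exprn_ge0 // -exprS.
Qed.

End Subexponential.

(** * Sums, products and derivatives of power series on the unit disc *)

Section PowerSeries.
Variable R : realType.
Local Notation C := (CC R).

Lemma csum_cvg_eq (u : nat -> C) l : series u @ \oo --> l -> csum u = l.
Proof. exact: ccvg_lim. Qed.

Lemma cabs_lim_le (u : nat -> C) l K :
  u @ \oo --> l -> (forall n, cabs (u n) <= K) -> cabs l <= K.
Proof.
move=> /ccvgP/cvgrPdist_lt H Hu; rewrite leNgt; apply/negP => Kl.
have e0 : 0 < cabs l - K by rewrite subr_gt0.
have [N _ /(_ N (leqnn N))] := H _ e0.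
rewrite /= sub0r normrN ger0_norm ?cabs_ge0 // cabsB ltrBrDl -ltrBrDr => /lt_le_trans.
move=> /(_ (cabs (u N))); rewrite ltNge => /(_ _)/negP; apply; last exact: Hu.
by rewrite lerBlDr -[X in cabs X <= _](subrK (u N)) addrC cabsD.
Qed.

Definition psum (a : nat -> C) (z : C) : C := csum (fun n => a n * z ^+ n).

Lemma psum_cvg a z : subexp a -> cabs z < 1 ->
  series (fun n => a n * z ^+ n) @ \oo --> psum a z.
Proof.
move=> Ha z1; have r01 : 0 <= cabs z < 1 by rewrite cabs_ge0.
have [M HM] := Ha _ r01.
have [l Hl] : exists l : C, series (fun n => a n * z ^+ n) @ \oo --> l.
  apply: (@abs_series_cvg _ _ M) => N; apply: le_trans (HM N).
  by apply: ler_sum => i _; rewrite cabsM cabsX.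
by rewrite /psum (csum_cvg_eq Hl).
Qed.

Lemma psum_partial (a : nat -> C) z n :
  series (fun n => a n * z ^+ n) n = \sum_(i < n) a i * z ^+ i.
Proof. by rewrite seriesEnat /= big_mkord. Qed.

Lemma psumP a z l : series (fun n => a n * z ^+ n) @ \oo --> l -> psum a z = l.
Proof. exact: csum_cvg_eq. Qed.

Lemma eq_psum a b z : a =1 b -> psum a z = psum b z.
Proof. by move=> ab; rewrite /psum; congr csum; apply/funext => n; rewrite ab. Qed.

Lemma psumD a b z : subexp a -> subexp b -> cabs z < 1 ->
  psum (fun n => a n + b n) z = psum a z + psum b z.
Proof.
move=> Ha Hb z1; apply: psumP.
have -> : series (fun n => (a n + b n) * z ^+ n) =
   (fun n => series (fun n => a n * z ^+ n) n + series (fun n => b n * z ^+ n) n).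
  apply/funext => n; rewrite !psum_partial -big_split /=.
  by apply: eq_bigr => i _; rewrite mulrDl.
by apply: cvgD; apply: psum_cvg.
Qed.

Lemma psumZ c a z : subexp a -> cabs z < 1 -> psum (fun n => c * a n) z = c * psum a z.
Proof.
move=> Ha z1; apply: psumP.
have -> : series (fun n => (c * a n) * z ^+ n) = (fun n => c * series (fun n => a n * z ^+ n) n).
  apply/funext => n; rewrite !psum_partial mulr_sumr.
  by apply: eq_bigr => i _; rewrite mulrA.
by apply: cvgM; [exact: cvg_cst | exact: psum_cvg].
Qed.

Lemma cvg_invS (K : R) : (fun n => K / n.+1%:R) @ \oo --> (0 : R).
Proof.
by rewrite -(mulr0 K); apply: cvgM; [exact: cvg_cst | exact: cvg_harmonic].
Qed.

(* The terms with [i + j >= N] of the double sum are [O(1/N)] because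
   [n r^n = O(s^n)] for every [s > r]. *)
Lemma psumM a b z : subexp a -> subexp b -> cabs z < 1 ->
  psum (ps_mul a b) z = psum a z * psum b z.
Proof.
move=> Ha Hb z1; apply: psumP.
have r01 : 0 <= cabs z < 1 by rewrite cabs_ge0.
have [s [rs s01 s0]] := between1 r01.
have [M HM] := Ha _ s01; have [M' HM'] := Hb _ s01.
have Hab : (fun n => series (fun n => a n * z ^+ n) n * series (fun n => b n * z ^+ n) n) @ \oo
    --> psum a z * psum b z by apply: cvgM; apply: psum_cvg.
pose e n := series (fun n => ps_mul a b n * z ^+ n) n
  - series (fun n => a n * z ^+ n) n * series (fun n => b n * z ^+ n) n.
have -> : series (fun n => ps_mul a b n * z ^+ n) =
   (fun n => e n + series (fun n => a n * z ^+ n) n * series (fun n => b n * z ^+ n) n).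
  by apply/funext => n; rewrite /e subrK.
rewrite -[X in _ --> X]add0r; apply: cvgD; last exact: Hab.
apply: (ccvg_le (cvg_invS (M * M' / (s - cabs z)))) => N.
rewrite subr0 /e !psum_partial big_distrlr /=.
rewrite (square_sum (fun i j => a i * z ^+ i * (b j * z ^+ j))).
have -> : \sum_(n < N) ps_mul a b n * z ^+ n =
  \sum_(n < N) \sum_(i < n.+1) a i * z ^+ i * (b (n - i)%N * z ^+ (n - i)).
  apply: eq_bigr => n _; rewrite /ps_mul mulr_suml; apply: eq_bigr => i _.
  have -> : z ^+ n = z ^+ i * z ^+ (n - i) by rewrite -exprD subnKC // -ltnS.
  by rewrite mulrACA.
rewrite opprD addrA subrr sub0r cabsN.
rewrite ler_pdivlMr ?ltr0Sn // ler_pdivlMr ?subr_gt0 //.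
apply: le_trans (_ : (\sum_(i < N) cabs (a i) * s ^+ i) * (\sum_(i < N) cabs (b i) * s ^+ i) <= _).
  rewrite big_distrlr /=.
  apply: le_trans (_ : (\sum_(i < N) \sum_(N - i <= j < N)
     cabs (a i * z ^+ i * (b j * z ^+ j))) * N.+1%:R * (s - cabs z) <= _).
    rewrite ler_wpM2r ?subr_ge0 ?(ltW rs) // ler_wpM2r ?ler0n //.
    apply: le_trans (cabs_sum _ _ _) _; apply: ler_sum => i _; exact: cabs_sum.
  rewrite !mulr_suml; apply: ler_sum => i _.
  rewrite -(big_mkord xpredT (fun j => cabs (a i) * s ^+ i * (cabs (b j) * s ^+ j))).
  rewrite [leRHS](big_cat_nat (n := N - i)) ?leq_subr //=; apply: ler_wpDl.
    by apply: sumr_ge0 => j _; rewrite !mulr_ge0 ?exprn_ge0 ?cabs_ge0 ?(ltW s0).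
  rewrite !mulr_suml; apply: ler_sum_nat => j /andP[Nj jN].
  rewrite !cabsM !cabsX.
  have -> : cabs (a i) * cabs z ^+ i * (cabs (b j) * cabs z ^+ j) * N.+1%:R * (s - cabs z)
    = cabs (a i) * cabs (b j) * (N.+1%:R * cabs z ^+ (i + j) * (s - cabs z)).
    by rewrite exprD; ring.
  rewrite [leRHS]mulrACA -exprD ler_wpM2l ?mulr_ge0 ?cabs_ge0 //.
  have [_ s1] := andP s01.
  (* As i + j >= N here, the factor N+1 is at most i+j+1, which the passage from |z| to s
     absorbs. *)
  apply: le_trans (mulS_expr_le (i + j) (cabs_ge0 z) (ltW rs) (ltW s1)).
  rewrite ler_wpM2r ?subr_ge0 ?(ltW rs) // ler_wpM2r ?exprn_ge0 ?cabs_ge0 //.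
  by rewrite ler_nat ltnS; lia.
have s0' := ltW s0.
by apply: ler_pM => //; apply: sumr_ge0 => i _; rewrite mulr_ge0 ?cabs_ge0 ?exprn_ge0.
Qed.

Lemma is_derive_littleo (f : C -> C) (z d : C) :
  (forall e : R, 0 < e -> exists2 t : R, 0 < t &
     forall h : C, cabs h < t -> cabs (f (z + h) - f z - h * d) <= e * cabs h) ->
  is_derive z 1 f d.
Proof.
move=> H.
have Hd : (fun h : C => h^-1 *: ((f \o shift z) (h *: (1 : C)) - f z)) @ 0^' --> d.
  apply/cvgrPdist_le => e e0.
  have [r r0 er] : exists2 r : R, 0 < r & e = r%:C%C.
    exists (complex.Re e); first by move: e0; rewrite ltcE => /andP[].
    by move: e0; case: e => a b; rewrite ltcE /= => /andP[/eqP -> _].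
  have [t t0 Ht] := H r r0.
  have t0' : 0 < t%:C%C :> R[i] by rewrite ltcR.
  near=> h.
  have h0 : h != 0 by near: h; exact: nbhs_dnbhs_neq.
  have ht : cabs h < t.
    rewrite -ltcR cabsE; near: h.
    by apply: dnbhs0_lt.
  rewrite er -cabsE lecR cabsB /= [h *: (1 : C)]mulr1.
  rewrite -[leRHS]mulr1 -(ler_pM2r (_ : 0 < cabs h)); last first.
    by rewrite lt0r cabs_eq0 h0 cabs_ge0.
  rewrite mulr1 -cabsM; apply: le_trans (Ht h ht); rewrite le_eqVlt; apply/orP; left.
  apply/eqP; congr cabs; rewrite -[_ *: _]/(h^-1 * _) [h + z]addrC.
  by field.
split; first by apply/cvg_ex; exists d.
by apply: cvg_lim Hd; exact: norm_hausdorff.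
Unshelve. all: by end_near.
Qed.

(** Below e / (|K| + 1) the quadratic remainder is at most e |h|; the added 1 covers K = 0. *)
Lemma is_derive_quad (f : C -> C) (z d : C) (K t : R) : 0 < t ->
  (forall h : C, cabs h < t -> cabs (f (z + h) - f z - h * d) <= K * cabs h ^+ 2) ->
  is_derive z 1 f d.
Proof.
move=> t0 H; apply: is_derive_littleo => e e0.
exists (Num.min t (e / (`|K| + 1))).
  by rewrite lt_min t0 /= divr_gt0 // ltr_wpDl.
move=> h; rewrite lt_min => /andP[h1]; rewrite ltr_pdivlMr ?ltr_wpDl // => h2.
apply: le_trans (H h h1) _; rewrite expr2 mulrA ler_wpM2r ?cabs_ge0 //.
apply: le_trans (ltW h2); rewrite mulrC ler_wpM2l ?cabs_ge0 //.
by apply: le_trans (ler_norm _) _; rewrite lerDl.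
Qed.

Definition dseq (a : nat -> C) : nat -> C := fun n => n.+1%:R * a n.+1.

Lemma subexp_dseq a : subexp a -> subexp (dseq a).
Proof.
move=> Ha; have Ha' := rsubexp_shift (fun n => cabs_ge0 (a n)) Ha.
apply: rsubexp_le (rsubexp_mulS (fun n => cabs_ge0 (a n.+1)) Ha') => n.
by rewrite cabsM cabs_nat.
Qed.

(** The remainder is of size (n+1)^2 |h|^2 r^(n-1); multiplying by [r] avoids the exponent n-1 at n
    = 0. In the induction the new remainder is (z + h) times the old one plus (n+1) h^2 z^n, and
    (n+1)^2 + (n+1) <= (n+2)^2. *)
Lemma expr_taylor (z h : C) (r : R) n : 0 <= r -> cabs z <= r -> cabs (z + h) <= r ->
  cabs ((z + h) ^+ n.+1 - z ^+ n.+1 - n.+1%:R * h * z ^+ n) * r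
    <= n.+1%:R ^+ 2 * cabs h ^+ 2 * r ^+ n.
Proof.
move=> r0 zr zhr; elim: n => [|n IH].
  have -> : (z + h) ^+ 1 - z ^+ 1 - 1%:R * h * z ^+ 0 = 0 by rewrite expr0 !expr1; ring.
  by rewrite cabs0 mul0r !mulr_ge0 ?exprn_ge0 ?cabs_ge0.
have -> : (z + h) ^+ n.+2 - z ^+ n.+2 - n.+2%:R * h * z ^+ n.+1 =
   (z + h) * ((z + h) ^+ n.+1 - z ^+ n.+1 - n.+1%:R * h * z ^+ n) + n.+1%:R * h ^+ 2 * z ^+ n.
  rewrite -[n.+2%:R]natr1 !(exprS _ n.+1) !(exprS _ n); ring.
apply: le_trans (_ : (r * (n.+1%:R ^+ 2 * cabs h ^+ 2 * r ^+ n)) + n.+1%:R * cabs h ^+ 2 * r ^+ n * r <= _).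
  apply: le_trans (_ : (cabs ((z + h) * ((z + h) ^+ n.+1 - z ^+ n.+1 - n.+1%:R * h * z ^+ n))
     + cabs (n.+1%:R * h ^+ 2 * z ^+ n)) * r <= _).
    by rewrite ler_wpM2r // cabsD.
  rewrite mulrDl; apply: lerD.
    rewrite cabsM -mulrA; apply: ler_pM => //; first exact: cabs_ge0.
    by rewrite mulr_ge0 ?cabs_ge0.
  rewrite ler_wpM2r // !cabsM !cabsX cabs_nat ler_wpM2l ?mulr_ge0 ?exprn_ge0 ?cabs_ge0 //.
  by rewrite lerXn2r // nnegrE cabs_ge0.
rewrite -[n.+2%:R]natr1 [r ^+ n.+1]exprS.
have n0 : 0 <= n.+1%:R :> R by [].
move: (n.+1%:R : R) n0 => x x0.
have -> : (x + 1) ^+ 2 * cabs h ^+ 2 * (r * r ^+ n)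
  = r * (x ^+ 2 * cabs h ^+ 2 * r ^+ n) + x * cabs h ^+ 2 * r ^+ n * r
    + (x + 1) * (cabs h ^+ 2 * r ^+ n * r) by ring.
by rewrite lerDl !mulr_ge0 ?exprn_ge0 ?cabs_ge0 ?addr_ge0.
Qed.

(** The Taylor remainders of the monomials are summed on partial sums with a bound independent of
    [N], which survives the limit. *)
Lemma is_derive_psum a z : subexp a -> cabs z < 1 -> is_derive z 1 (psum a) (psum (dseq a) z).
Proof.
move=> Ha z1; have r01 : 0 <= cabs z < 1 by rewrite cabs_ge0.
have [r [zr r01' r0]] := between1 r01.
have Ha2 : rsubexp (fun n => n.+1%:R * (n.+1%:R * cabs (a n.+1))).
  apply: rsubexp_mulS => [n|]; first by rewrite mulr_ge0 ?cabs_ge0.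
  apply: rsubexp_mulS => [n|]; first exact: cabs_ge0.
  exact: rsubexp_shift (fun n => cabs_ge0 (a n)) Ha.
have [M HM] := Ha2 _ r01'.
(* [M] bounds the sums of (n+1)^2 |a_(n+1)| r^n; the division by [r] repays the factor [r] in
   [expr_taylor]. *)
apply: (@is_derive_quad _ _ _ (M / r) (r - cabs z)) => [|h hr]; first by rewrite subr_gt0.
have zhr : cabs (z + h) <= r.
  by apply: le_trans (cabsD _ _) _; rewrite -lerBrDl ltW.
have [_ r1] := andP r01'.
have Hl : (fun N => series (fun n => a n * (z + h) ^+ n) N.+1 - series (fun n => a n * z ^+ n) N.+1
   - h * series (fun n => dseq a n * z ^+ n) N) @ \oo
   --> psum a (z + h) - psum a z - h * psum (dseq a) z.
  apply: cvgB; last first.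
    by apply: cvgM; [exact: cvg_cst | apply: psum_cvg => //; exact: subexp_dseq].
  apply: cvgB; rewrite (cvg_shiftS (series _)); apply: psum_cvg => //.
  by apply: le_lt_trans r1.
apply: (cabs_lim_le Hl) => N.
rewrite !psum_partial !(big_ord_recl N) /= !expr0 opprD addrACA subrr add0r mulr_sumr -!sumrB.
rewrite mulrAC ler_pdivlMr // [leRHS]mulrC.
apply: le_trans (_ : (\sum_(i < N) cabs (a i.+1) * cabs ((z + h) ^+ i.+1 - z ^+ i.+1 - i.+1%:R * h * z ^+ i)) * r <= _).
  rewrite ler_wpM2r ?(ltW r0) //; apply: le_trans (cabs_sum _ _ _) _.
  apply: ler_sum => i _; rewrite -cabsM le_eqVlt; apply/orP; left; apply/eqP; congr cabs.
  rewrite /dseq /bump /= add1n; ring.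
apply: le_trans (ler_wpM2l (exprn_ge0 2 (cabs_ge0 h)) (HM N)).
rewrite mulr_suml mulr_sumr; apply: ler_sum => i _.
have -> : cabs h ^+ 2 * (i.+1%:R * (i.+1%:R * cabs (a i.+1)) * r ^+ i)
  = cabs (a i.+1) * (i.+1%:R ^+ 2 * cabs h ^+ 2 * r ^+ i) by ring.
by rewrite -mulrA ler_wpM2l ?cabs_ge0 // expr_taylor // ltW.
Qed.

End PowerSeries.

(** * The complex exponential, powers of q and roots of unity *)

Lemma is_derive_comp1 (K : numFieldType) (f g : K^o -> K^o) (x a b : K^o) :
  is_derive (g x) 1 f a -> is_derive x 1 g b -> is_derive x 1 (f \o g) (a * b).
Proof.
move=> [fgx fa] [gx gb].
have df : differentiable f (g x) by move/derivable1_diffP: fgx.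
have dg : differentiable g x by move/derivable1_diffP: gx.
have dfg := differentiable_comp dg df.
split; first by apply/derivable1_diffP.
rewrite deriveE //.
have gE : 'd g x 1 = b by rewrite -deriveE.
have fE : 'd f (g x) b = b * a by rewrite diff1E // derive1E fa.
have H : 'd (f \o g) x 1 = 'd f (g x) ('d g x 1) := congr1 (fun F : K^o -> K^o => F 1) (diff_comp dg df).
exact: (etrans H (etrans (congr1 ('d f (g x)) gE) (etrans fE (mulrC _ _)))).
Qed.

Section ComplexExponential.
Variable R : realType.
Local Notation C := (CC R).

Lemma is_derive_compC (f g : C -> C) (x a b : C) :
  is_derive (g x) 1 f a -> is_derive x 1 g b -> is_derive x 1 (f \o g) (a * b).
Proof. exact: is_derive_comp1. Qed.

Lemma real_derive_littleo (f : R -> R) (x d : R) : is_derive x 1 f d ->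
  forall e : R, 0 < e -> exists2 t : R, 0 < t &
    forall h, `|h| < t -> `|f (x + h) - f x - h * d| <= e * `|h|.
Proof.
move=> [dx dd] e e0.
have H : (fun h : R => h^-1 *: ((f \o shift x) (h *: (1 : R)) - f x)) @ 0^' --> d.
  by rewrite -dd; exact: dx.
move/cvgrPdist_le : H => /(_ e e0) /nbhs_ballP[t /= t0 Ht].
exists t => // h ht; have [->|h0] := eqVneq h 0.
  by rewrite addr0 subrr mul0r subr0 normr0 mulr0.
have /= := Ht h; rewrite /ball /= sub0r normrN => /(_ ht h0).
rewrite distrC [h *: (1 : R)]mulr1 [h + x]addrC => H.
have -> : f (x + h) - f x - h * d = h * (h^-1 *: (f (x + h) - f x) - d).
  by rewrite -[_ *: _]/(h^-1 * _); field.
by rewrite normrM mulrC ler_wpM2r.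
Qed.

Lemma cexpD (z w : C) : cexp (z + w) = cexp z * cexp w.
Proof.
rewrite /cexp cReD cImD expRD cosD sinD.
rewrite [RHS]cmkE cReM cImM /=; congr cmk; ring.
Qed.

Lemma cexp0 : cexp (0 : C) = 1.
Proof. by rewrite /cexp /= expR0 cos0 sin0 mul1r mulr0. Qed.

Lemma cabs_cexp (z : C) : cabs (cexp z) = expR (cRe z).
Proof.
rewrite /cabs /cexp /cmk normc_def /=.
rewrite !exprMn -mulrDr cos2Dsin2 mulr1 sqrtr_sqr ger0_norm //; exact: expR_ge0.
Qed.

(** [cexp] is given by real exp, cos and sin, so its derivative at 0 is assembled from their three
    real derivatives at 0; the functional equation then carries it to every point. *)
Lemma cexp_sub1_littleo (e : R) : 0 < e -> exists2 t : R, 0 < t &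
  forall h : C, cabs h < t -> cabs (cexp h - 1 - h) <= e * cabs h.
Proof.
(* The final estimate adds up to 7 d |h|, hence e/8. The bound 1/2 keeps the real exponential below
   2. *)
move=> e0; have [d [d0 de d1]] : exists d : R, [/\ 0 < d, d <= e / 8 & d <= 1 / 2].
  exists (Num.min (e / 8) (1 / 2)); split; first by rewrite lt_min; apply/andP; split; lra.
    by rewrite ge_min lexx.
  by rewrite ge_min lexx orbT.
have [t1 t10 H1] := real_derive_littleo (is_derive_expR 0) d0.
have [t2 t20 H2] := real_derive_littleo (is_derive_cos 0) d0.
have [t3 t30 H3] := real_derive_littleo (is_derive_sin 0) d0.
exists (Num.min d (Num.min t1 (Num.min t2 t3))); first by rewrite !lt_min d0 t10 t20 t30.
move=> h; rewrite !lt_min => /and4P[hd h1 h2 h3].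
have xh := cabs_geRe h; have yh := cabs_geIm h.
have := H1 _ (le_lt_trans xh h1); have := H2 _ (le_lt_trans yh h2).
have := H3 _ (le_lt_trans yh h3).
rewrite !add0r cos0 sin0 expR0 oppr0 mulr0 !mulr1 !subr0 addr0 => Hs Hc He.
apply: le_trans (cabs_leReIm _) _.
rewrite !cReD !cImD !cReN !cImN /=.
move: xh yh hd Hs Hc He; set x := cRe h; set y := cIm h; set m := cabs h => xh yh hd Hs Hc He.
have m0 : 0 <= m by exact: cabs_ge0.
have x0 := normr_ge0 x; have y0 := normr_ge0 y.
have Ex : `|expR x - 1| <= 2 * `|x|.
  have -> : expR x - 1 = (expR x - 1 - x) + x by ring.
  apply: le_trans (ler_normD _ _) _.
  have : d * `|x| <= 1 / 2 * `|x| by rewrite ler_wpM2r.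
  by lra.
have E2 : `|expR x| <= 2.
  have -> : expR x = (expR x - 1) + 1 by ring.
  apply: le_trans (ler_normD _ _) _; rewrite normr1; lra.
have -> : expR x * cos y - 1 - x = expR x * (cos y - 1) + (expR x - 1 - x) by ring.
have -> : expR x * sin y - 0 - y = expR x * (sin y - y) + (expR x - 1) * y by ring.
have B1 : `|expR x * (cos y - 1)| <= 2 * (d * m).
  rewrite normrM; apply: ler_pM => //; apply: le_trans Hc _; rewrite ler_wpM2l //; exact: ltW.
have B2 : `|expR x * (sin y - y)| <= 2 * (d * m).
  rewrite normrM; apply: ler_pM => //; apply: le_trans Hs _; rewrite ler_wpM2l //; exact: ltW.
have B3 : `|(expR x - 1) * y| <= 2 * (d * m).
  rewrite normrM mulrA; apply: ler_pM => //; apply: le_trans Ex _; rewrite ler_wpM2l //.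
  by apply: le_trans xh _; exact: ltW.
have B4 : `|expR x - 1 - x| <= d * m.
  by apply: le_trans He _; rewrite ler_wpM2l // ltW.
have B5 : d * m <= e / 8 * m by rewrite ler_wpM2r.
apply: le_trans (lerD (ler_normD _ _) (ler_normD _ _)) _.
have : 0 <= e * m by rewrite mulr_ge0 // ltW.
move: B1 B2 B3 B4 B5; rewrite [e / 8 * m]mulrAC; lra.
Qed.

Lemma is_derive_cexp (z : C) : is_derive z 1 (@cexp R) (cexp z).
Proof.
apply: is_derive_littleo => e e0.
have k0 : 0 < cabs (cexp z) by rewrite cabs_cexp expR_gt0.
have [t t0 Ht] := cexp_sub1_littleo (divr_gt0 e0 k0).
exists t => // h /Ht H; rewrite cexpD.
have -> : cexp z * cexp h - cexp z - h * cexp z = cexp z * (cexp h - 1 - h) by ring.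
rewrite cabsM; apply: le_trans (ler_wpM2l (ltW k0) H) _.
by rewrite mulrA mulrCA divff ?gt_eqF // mulr1.
Qed.

Lemma is_derive_qpow (x tau : C) : is_derive tau 1 (qpow x) (@twopii R * x * qpow x tau).
Proof.
have H : is_derive tau 1 (fun t : C => @twopii R * x * t) (@twopii R * x).
  apply: (@is_derive_quad _ _ _ _ 0 1) => // h _.
  have -> : @twopii R * x * (tau + h) - @twopii R * x * tau - h * (@twopii R * x) = 0 by ring.
  by rewrite cabs0 mul0r.
rewrite mulrC; exact: is_derive_compC (is_derive_cexp _) H.
Qed.

Lemma qpowD (x y tau : C) : qpow (x + y) tau = qpow x tau * qpow y tau.
Proof. by rewrite /qpow mulrDr mulrDl cexpD. Qed.

Lemma qpow0 (tau : C) : qpow 0 tau = 1.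
Proof. by rewrite /qpow mulr0 mul0r cexp0. Qed.

Lemma qpow_natM (x : C) n tau : qpow (n%:R * x) tau = qpow x tau ^+ n.
Proof.
elim: n => [|n IH]; first by rewrite mul0r qpow0.
by rewrite -natr1 mulrDl mul1r qpowD IH exprSr.
Qed.

Lemma cRe_nat n : cRe (n%:R : C) = n%:R.
Proof. by rewrite /cRe raddfMn. Qed.
Lemma cIm_nat n : cIm (n%:R : C) = 0.
Proof. by rewrite /cIm raddfMn /= mul0rn. Qed.

Lemma cnatV (n : nat) : (n%:R : C)^-1 = cmk (n%:R^-1) 0.
Proof. by rewrite -[n%:R](rmorph_nat (real_complex R)) -fmorphV. Qed.

(** The exponent 2 pi i tau / T has real part -2 pi Im(tau) / T. *)
Lemma cabs_qpow (T : nat) (tau : C) : (0 < T)%N -> 0 < cIm tau ->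
  cabs (qpow (T%:R^-1) tau) < 1.
Proof.
move=> T0 t0; rewrite /qpow cabs_cexp expR_lt1 cnatV.
rewrite !cReM !cImM /= !(mul0r, mulr0, subr0, addr0, add0r, sub0r, oppr0) oppr_lt0.
by rewrite !mulr_gt0 ?pi_gt0 // invr_gt0 ltr0n.
Qed.

Lemma rootT_X T j n : rootT R T j ^+ n = rootT R T (n * j).
Proof.
have -> : rootT R T j = qpow (T%:R^-1) j%:R by rewrite /rootT /qpow mulrAC.
have -> : rootT R T (n * j) = qpow (T%:R^-1) (n * j)%:R by rewrite /rootT /qpow mulrAC.
elim: n => [|n IH]; first by rewrite mul0n /qpow mulr0 cexp0.
by rewrite exprSr IH mulSn addnC /qpow natrD mulrDr cexpD.
Qed.

Lemma rootT_cmk T j : rootT R T j = cmk (cos (2 * pi * (j%:R / T%:R))) (sin (2 * pi * (j%:R / T%:R))).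
Proof.
rewrite /rootT /cexp cnatV !cReM !cImM cRe_nat cIm_nat /=.
rewrite !(mul0r, mulr0, subr0, addr0, add0r, sub0r, oppr0) expR0 !mul1r.
by rewrite !mulrA.
Qed.

Lemma rootT_order T : (0 < T)%N -> rootT R T 1 ^+ T = 1.
Proof.
move=> T0; rewrite rootT_X muln1 rootT_cmk divff ?pnatr_eq0 -?lt0n // mulr1.
by rewrite mulrC mulr_natr cos2pi sin2pi.
Qed.

(** With theta = pi i/T, a root equal to 1 gives cos(2 theta) = 1, hence sin(theta) = 0, although 0
    < theta < pi. *)
Lemma rootT_neq1 T i : (0 < i < T)%N -> rootT R T i != 1.
Proof.
move=> /andP[i0 iT]; have T0 : (0 : R) < T%:R by rewrite ltr0n (leq_trans _ iT).
apply/eqP; rewrite rootT_cmk => /(congr1 (@cRe R)) /=.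
have -> : 2 * pi * (i%:R / T%:R) = (pi * (i%:R / T%:R)) *+ 2 :> R by rewrite mulr2n; ring.
rewrite cos_mulr2n => H.
have : sin (pi * (i%:R / T%:R)) ^+ 2 = 0 :> R.
  rewrite sin2cos2; apply: (@mulIf _ 2) => //; move: H; rewrite mulr2n; lra.
move/eqP; rewrite sqrf_eq0; apply/negP; rewrite gt_eqF // sin_gt0_pi //.
have q1 : i%:R / T%:R < 1 :> R by rewrite ltr_pdivrMr // mul1r ltr_nat.
have q0 : 0 < i%:R / T%:R :> R by rewrite divr_gt0 // ltr0n.
by rewrite mulr_gt0 ?pi_gt0 //= gtr_pMr ?pi_gt0.
Qed.

End ComplexExponential.

(** * The q-expansions of E_2k and Q_k converge to the functions *)

Section QExpansions.
Variable R : realType.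
Local Notation C := (CC R).

Lemma sum_widen (A : nmodType) (F : nat -> A) a b : (a <= b)%N ->
  (forall i, (a <= i)%N -> (i < b)%N -> F i = 0) -> \sum_(i < b) F i = \sum_(i < a) F i.
Proof.
move=> ab H; rewrite -!(big_mkord xpredT) (big_cat_nat (n := a)) //=.
rewrite [X in _ + X]big_nat [X in _ + X]big1 ?addr0 // => i /andP[? ?]; exact: H.
Qed.

Lemma subexp_poly (a : nat -> C) c d : (forall n, cabs (a n) <= c * n.+1%:R ^+ d) -> subexp a.
Proof.
move=> H; apply: rsubexp_le (rsubexp_poly d (normr_ge0 c)) => n; apply: le_trans (H n) _.
by rewrite ler_wpM2r ?exprn_ge0 // ler_norm.
Qed.

(** The terms with exponent [d.+1] have bounded sums, so those with exponent [d] are O(1/(n+1)). *)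
Lemma cvg_poly_expr (c r : R) d : 0 <= c -> 0 <= r < 1 ->
  (fun n => c * n.+1%:R ^+ d * r ^+ n) @ \oo --> (0 : R).
Proof.
move=> c0 r01; have [M HM] := rsubexp_poly d.+1 c0 r01; have [r0 _] := andP r01.
apply: (squeeze_cvgr _ (cvg_cst (0 : R)) (cvg_invS M)).
near=> n; apply/andP; split; first by rewrite !mulr_ge0 ?exprn_ge0.
rewrite ler_pdivlMr ?ltr0Sn //; apply: le_trans (HM n.+1).
rewrite big_ord_recr /=; apply: ler_wpDl.
  by apply: sumr_ge0 => i _; rewrite !mulr_ge0 ?exprn_ge0.
by rewrite le_eqVlt; apply/orP; left; apply/eqP; rewrite exprS; ring.
Unshelve. all: by end_near.
Qed.

Lemma cvg_subseq (u : nat -> C) (l : C) (f : nat -> nat) :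
  (forall n, (n <= f n)%N) -> u @ \oo --> l -> (u \o f) @ \oo --> l.
Proof.
move=> hf H A /H[N _ HN]; exists N => // n Nn.
by apply: HN; exact: leq_trans Nn (hf n).
Qed.

Definition delta (c : C) : nat -> C := fun r => (r == 0%N)%:R * c.

Lemma subexp_delta c : subexp (delta c).
Proof.
apply: (@subexp_poly _ (cabs c) 0) => n; rewrite expr0 mulr1 /delta cabsM cabs_nat.
by rewrite ler_piMl ?cabs_ge0 //; case: (n == 0%N).
Qed.

Lemma series_delta c : series (delta c) @ \oo --> c.
Proof.
apply/cvg_ballP => e e0; exists 1%N => // n /= n1.
suff -> : series (delta c) n = c by exact: ballxx.
rewrite seriesEnat /= big_mkord (@sum_widen _ (delta c) 1) //.
  by rewrite big_ord1 /delta mul1r.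
by move=> i i1 _; rewrite /delta eqn0Ngt i1 mul0r.
Qed.

Lemma psum_delta c z : psum (delta c) z = c.
Proof.
apply: psumP; have -> : (fun n => delta c n * z ^+ n) = delta c; last exact: series_delta.
by apply/funext => -[|n]; rewrite /delta ?expr0 ?mulr1 // !mul0r.
Qed.

(** Coefficient of x^r in the Lambert series sum_n c_n sum_(m>=1) t^m x^(m e(n)). The guard [0 < r]
    drops the indices with e(n) = 0, whose geometric sum is constant in x. Both infinite sums in Q_k
    have this shape, with e(n) = nT + j and e(n) = nT - j. *)
Definition lambert (c : nat -> C) (t : C) (e : nat -> nat) : nat -> C := fun r =>
  \sum_(m < r.+1) \sum_(n < r.+1)
    (if [&& (0 < m)%N, (0 < r)%N & (m * e n == r)%N] then t ^+ m * c n else 0).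

(** There are (r+1)^2 terms, each at most A (r+1)^d because |t| = 1. *)
Lemma lambert_subexp c t e A d : cabs t = 1 -> (forall n, cabs (c n) <= A * n.+1%:R ^+ d) ->
  subexp (lambert c t e).
Proof.
move=> t1 Hc.
have A0 : 0 <= A.
  by have := Hc 0%N; rewrite expr1n mulr1; apply: le_trans; exact: cabs_ge0.
apply: (@subexp_poly _ A d.+2) => r; rewrite /lambert.
apply: le_trans (_ : \sum_(m < r.+1) \sum_(n < r.+1) A * r.+1%:R ^+ d <= _); last first.
  rewrite sumr_const card_ord sumr_const card_ord -mulrnA -[leLHS]mulr_natr natrM.
  by rewrite 2!exprSr !mulrA.
apply: le_trans (cabs_sum _ _ _) _; apply: ler_sum => m _.
apply: le_trans (cabs_sum _ _ _) _; apply: ler_sum => n _.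
case: ifP => _; last by rewrite cabs0 mulr_ge0 ?exprn_ge0.
rewrite cabsM cabsX t1 expr1n mul1r; apply: le_trans (Hc n) _.
by rewrite ler_wpM2l // lerXn2r // ?nnegrE // ler_nat ltnS -ltnS.
Qed.

Lemma geometric_remainder (w : C) P : w != 1 ->
  w / (1 - w) - \sum_(m < P.+1) (if (0 < m)%N then w ^+ m else 0) = w ^+ P.+1 / (1 - w).
Proof.
move=> w1; have w1' : 1 - w != 0 by rewrite subr_eq0 eq_sym.
elim: P => [|P IH]; first by rewrite big_ord1 subr0 expr1.
by rewrite big_ord_recr /= opprD addrA IH [w ^+ P.+2]exprS; field.
Qed.

Lemma lambert_tail (t z : C) e N : cabs t = 1 -> cabs z < 1 -> (0 < e)%N -> (0 < N)%N ->
  cabs (t * z ^+ e / (1 - t * z ^+ e) -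
        \sum_(m < N) (if (0 < m)%N && (m * e < N)%N then (t * z ^+ e) ^+ m else 0))
    <= cabs z ^+ N / (1 - cabs z).
Proof.
move=> t1 z1 e0 N0; set w := t * z ^+ e.
have z0 := cabs_ge0 z; have z1' := ltW z1.
have wz : cabs w <= cabs z.
  by rewrite cabsM t1 mul1r cabsX -[leRHS]expr1; apply: ler_wiXn2l.
have w1 : w != 1.
  by apply/eqP => E; move: (le_lt_trans wz z1); rewrite E cabs1 ltxx.
(* [P] is the largest m with m e < N, so the geometric remainder carries the exponent (P+1) e >=
   N. *)
pose P := (N.-1 %/ e)%N.
have PN : (P.+1 <= N)%N by rewrite -[X in (_ < X)%N](prednK N0) ltnS leq_div.
have PE m : (m * e < N)%N = (m < P.+1)%N.
  by rewrite ltnS leq_divRL // -{1}(prednK N0) ltnS.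
have -> : \sum_(m < N) (if (0 < m)%N && (m * e < N)%N then w ^+ m else 0)
  = \sum_(m < P.+1) (if (0 < m)%N then w ^+ m else 0).
  rewrite (@sum_widen _ (fun m => if (0 < m)%N && (m * e < N)%N then w ^+ m else 0) P.+1) //.
    by apply: eq_bigr => m _; rewrite PE ltn_ord andbT.
  by move=> i Pi _; rewrite PE [(i < _)%N]ltnNge Pi /= andbF.
rewrite geometric_remainder // cabsM cabsV cabsX.
apply: ler_pM; rewrite ?exprn_ge0 ?invr_ge0 ?cabs_ge0 //.
  rewrite /w cabsM t1 mul1r cabsX -exprM; apply: ler_wiXn2l => //.
  have := ltn_ceil N.-1 e0; rewrite -/P mulnC => H.
  by rewrite -(prednK N0).
rewrite lef_pV2 ?posrE ?subr_gt0 //.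
  have := cabs_leD 1 (- w); rewrite cabs1 cabsN; apply: le_trans.
  by rewrite lerD2l lerN2.
have := cabs_leD 1 (- w); rewrite cabs1 cabsN; apply: lt_le_trans.
by rewrite subr_gt0 (le_lt_trans wz).
Qed.

(** Since n <= e(n), every nonzero term with m e(n) = r < N and m > 0 has m, n < N. All three
    indices can therefore run over the same range and be interchanged. *)
Lemma lambert_partial c t e z N : (forall n, (n <= e n)%N) ->
  \sum_(r < N) lambert c t e r * z ^+ r =
  \sum_(n < N) c n * (if e n == 0%N then 0 else
     \sum_(m < N) (if (0 < m)%N && (m * e n < N)%N then (t * z ^+ e n) ^+ m else 0)).
Proof.
move=> ne.
pose G r m n := if [&& (0 < m)%N, (0 < r)%N & (m * e n == r)%N] then t ^+ m * c n else 0.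
have -> : \sum_(r < N) lambert c t e r * z ^+ r =
  \sum_(r < N) \sum_(m < N) \sum_(n < N) G r m n * z ^+ r.
  apply: eq_bigr => r _; rewrite /lambert mulr_suml.
  rewrite (@sum_widen _ (fun m => \sum_(n < N) G r m n * z ^+ r) r.+1) //; last first.
    move=> m rm _; apply: big1 => n _; rewrite /G; case: ifP; rewrite ?mul0r //.
    move=> /and3P[m0 r0 /eqP E]; move: r0 rm; rewrite -E; case: (e n) => [|k]; first by rewrite muln0.
    by move=> _; rewrite mulnS ltnNge leq_addr.
  apply: eq_bigr => m _; rewrite mulr_suml.
  rewrite (@sum_widen _ (fun n => G r m n * z ^+ r) r.+1 N) //.
  move=> n rn _; rewrite /G; case: ifP; rewrite ?mul0r //.
  move=> /and3P[m0 r0 /eqP E].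
  have : (m * e n <= r)%N by rewrite E.
  by rewrite leqNgt (leq_trans rn) // (leq_trans (ne n)) // leq_pmull.
under eq_bigr => r _ do rewrite exchange_big.
rewrite exchange_big /=; apply: eq_bigr => n _.
rewrite exchange_big /=.
have [e0|e0] := eqVneq (e n) 0%N.
  rewrite mulr0; apply: big1 => m _; apply: big1 => r _; rewrite /G e0 muln0.
  by case: ifP; rewrite ?mul0r // => /and3P[_ r0 /eqP E]; move: r0; rewrite -E.
rewrite mulr_sumr; apply: eq_bigr => m _.
case: ifP => [/andP[m0 mN]|H].
  rewrite (bigD1 (Ordinal mN)) //= big1 ?addr0.
    by rewrite /G m0 eqxx muln_gt0 m0 lt0n e0 /= exprMn -exprM [(e n * m)%N]mulnC; ring.
  move=> r rE; rewrite /G; case: ifP; rewrite ?mul0r // => /and3P[_ _ /eqP E].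
  by case/eqP: rE; apply: val_inj => /=.
rewrite mulr0; apply: big1 => r _; rewrite /G; case: ifP; rewrite ?mul0r //.
by move=> /and3P[m0 _ /eqP E]; move: H; rewrite m0 E ltn_ord.
Qed.

(* The difference of the partial sums is a sum of geometric tails, each [O(|z|^N)]. *)
Lemma lambert_cvg c t e z A d : cabs t = 1 -> cabs z < 1 -> (forall n, (n <= e n)%N) ->
  (forall n, cabs (c n) <= A * n.+1%:R ^+ d) ->
  series (fun n => if e n == 0%N then 0 else c n * (t * z ^+ e n / (1 - t * z ^+ e n))) @ \oo
    --> psum (lambert c t e) z.
Proof.
move=> t1 z1 ne Hc; have z0 := cabs_ge0 z.
have A0 : 0 <= A.
  by have := Hc 0%N; rewrite expr1n mulr1; apply: le_trans; exact: cabs_ge0.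
have HB := psum_cvg (lambert_subexp e t1 Hc) z1.
set u := (fun n => if e n == 0%N then _ else _).
have -> : series u = (fun N => (series u N - series (fun n => lambert c t e n * z ^+ n) N)
    + series (fun n => lambert c t e n * z ^+ n) N).
  by apply/funext => N; rewrite subrK.
rewrite -[X in _ --> X]add0r; apply: cvgD; last exact: HB.
have z01 : 0 <= cabs z < 1 by rewrite z0.
have K0 : 0 <= (1 - cabs z)^-1 by rewrite invr_ge0 subr_ge0 ltW.
apply: (ccvg_le (cvg_poly_expr d.+1 (mulr_ge0 A0 K0) z01)).
move=> N; rewrite subr0 psum_partial lambert_partial // seriesEnat /= big_mkord -sumrB.
apply: le_trans (cabs_sum _ _ _) _.
case: N => [|N].
  by rewrite big_ord0 !mulr_ge0 ?exprn_ge0.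
apply: le_trans (_ : \sum_(n < N.+1) A * N.+2%:R ^+ d * (cabs z ^+ N.+1 / (1 - cabs z)) <= _).
  apply: ler_sum => n _.
  rewrite /u; case: eqP => [_|/eqP en].
    by rewrite mulr0 subrr cabs0 !mulr_ge0 ?exprn_ge0.
  rewrite -mulrBr cabsM; apply: ler_pM; rewrite ?cabs_ge0 //.
    apply: le_trans (Hc n) _; rewrite ler_wpM2l // lerXn2r ?nnegrE //.
    by rewrite ler_nat; have := ltn_ord n; lia.
  by apply: lambert_tail => //; rewrite lt0n.
rewrite sumr_const card_ord -[leLHS]mulr_natr.
have -> : A * N.+2%:R ^+ d * (cabs z ^+ N.+1 / (1 - cabs z)) * N.+1%:R =
   (A / (1 - cabs z) * N.+2%:R ^+ d * cabs z ^+ N.+1) * N.+1%:R by ring.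
have -> : A / (1 - cabs z) * N.+2%:R ^+ d.+1 * cabs z ^+ N.+1 =
   (A / (1 - cabs z) * N.+2%:R ^+ d * cabs z ^+ N.+1) * N.+2%:R by rewrite exprSr; ring.
by rewrite ler_wpM2l ?ler_nat // !mulr_ge0 ?exprn_ge0.
Qed.

Lemma cabs_root1 (lam : C) n : (0 < n)%N -> lam ^+ n = 1 -> cabs lam = 1.
Proof.
move=> n0 E; apply/eqP; rewrite -(@pexpr_eq1 _ _ n) ?cabs_ge0 //.
by rewrite -cabsX E cabs1.
Qed.

Section Level.
Variables (T : nat) (tau : C).
Hypotheses (T0 : (0 < T)%N) (tau0 : 0 < cIm tau).
Let z := qpow (T%:R^-1) tau.

Let z1 : cabs z < 1. Proof. exact: cabs_qpow. Qed.

Lemma natC_neq0 n : (0 < n)%N -> (n%:R : C) != 0.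
Proof. by move=> n0; rewrite pnatr_eq0 -lt0n. Qed.

Lemma qpow_level n : qpow (n%:R / T%:R) tau = z ^+ n.
Proof. by rewrite qpow_natM. Qed.

(** The divisor sum has at most n+1 terms of size at most (n+1)^(2k-1); the first summand of the
    constant takes care of the coefficient at n = 0. *)
Lemma ecoef_poly k : exists c d, forall n, cabs (ecoef R k n) <= c * n.+1%:R ^+ d.
Proof.
set m := (2 * k).-1.
exists (cabs (ecoef R k 0) + cabs (2 / (m`!)%:R : C)), m.+1 => n.
have B0 : 1 <= (n.+1%:R : R) ^+ m.+1 by rewrite exprn_ege1 // ler1n.
rewrite mulrDl; case: n B0 => [|n] B0.
  by rewrite expr1n !mulr1 lerDl cabs_ge0.
apply: ler_wpDl; first by rewrite mulr_ge0 ?cabs_ge0 // exprn_ge0.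
rewrite /ecoef /= -/m cabsM ler_wpM2l ?cabs_ge0 // /sigmaf.
apply: le_trans (cabs_sum _ _ _) _.
apply: le_trans (_ : \sum_(i < n.+2) (n.+2%:R : R) ^+ m <= _).
  rewrite big_mkcond; apply: ler_sum => i _; case: ifP => _; last by rewrite exprn_ge0.
  by rewrite cabsX cabs_nat lerXn2r ?nnegrE // ler_nat ltnW.
by rewrite sumr_const card_ord -[leLHS]mulr_natr exprSr.
Qed.

Lemma subexp_ecoefT k : subexp (ecoefT R T k).
Proof.
have [c [d H]] := ecoef_poly k.
have c0 : 0 <= c.
  by have := H 0%N; rewrite expr1n mulr1; apply: le_trans; exact: cabs_ge0.
apply: (@subexp_poly _ c d) => n; rewrite /ecoefT; case: ifP => _.
  apply: le_trans (H _) _; rewrite ler_wpM2l // lerXn2r ?nnegrE // ler_nat ltnS.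
  exact: leq_div.
by rewrite cabs0 mulr_ge0 ?exprn_ge0.
Qed.

(** The partial sums in powers of q are those in powers of q^(1/T) taken at multiples of T. *)
Lemma Efun_psum k : Efun k tau = psum (ecoefT R T k) z.
Proof.
apply: csum_cvg_eq.
have H := cvg_subseq (fun n => leq_pmulr n T0) (psum_cvg (subexp_ecoefT k) z1).
suff -> : series (fun n => ecoef R k n * qpow n%:R tau) =
  series (fun n => ecoefT R T k n * z ^+ n) \o (fun n => n * T)%N by [].
apply/funext => n /=; rewrite psum_partial seriesEnat /= big_mkord.
elim: n => [|n IH]; first by rewrite mul0n !big_ord0.
rewrite big_ord_recr /= IH mulSn addnC.
rewrite -(big_mkord xpredT (fun i => ecoefT R T k i * z ^+ i)).
rewrite -(big_mkord xpredT (fun i => ecoefT R T k i * z ^+ i)).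
rewrite [RHS](big_cat_nat (n := (n * T)%N)) ?leq_addr //=; congr (_ + _).
rewrite big_ltn; last by rewrite -{1}[(n * T)%N]addn0 ltn_add2l.
rewrite [X in _ = _ + X]big_nat [X in _ = _ + X]big1 ?addr0.
  rewrite /ecoefT dvdn_mull // mulnK //; congr (_ * _).
  by rewrite -qpow_level natrM mulfK // natC_neq0.
move=> i /andP[i1 i2]; rewrite /ecoefT; case: ifP; rewrite ?mul0r //.
move=> /dvdnP[q iE]; move: i1 i2; rewrite iE ltn_pmul2r // => i1.
by rewrite addnC -mulSn ltn_pmul2r // ltnS leqNgt i1.
Qed.

Variables (j : nat) (lam : C) (T1 : nat).
Hypotheses (jT : (j < T)%N) (T10 : (0 < T1)%N) (lamT : lam ^+ T1 = 1).

Let lam1 : cabs lam = 1. Proof. exact: cabs_root1 lamT. Qed.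

Let c1 k n : C := (n%:R + j%:R / T%:R) ^+ k.
Let c2 k n : C := (n%:R - j%:R / T%:R) ^+ k.
Let e1 n := (n * T + j)%N.
(** Truncated subtraction gives [e2 0 = 0], so [lambert] skips n = 0, in agreement with the second
    sum of Q_k, which starts at n = 1. *)
Let e2 n := (n * T - j)%N.

Let frac1 : cabs (j%:R / T%:R : C) <= 1.
Proof.
rewrite cabsM cabsV !cabs_nat ler_pdivrMr ?ltr0n // mul1r ler_nat; exact: ltnW.
Qed.

Let c1_poly k n : cabs (c1 k n) <= 1 * n.+1%:R ^+ k.
Proof.
rewrite mul1r /c1 cabsX lerXn2r ?nnegrE ?cabs_ge0 //.
by apply: le_trans (cabsD _ _) _; rewrite cabs_nat -natr1 lerD2l frac1.
Qed.

Let c2_poly k n : cabs (c2 k n) <= 1 * n.+1%:R ^+ k.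
Proof.
rewrite mul1r /c2 cabsX lerXn2r ?nnegrE ?cabs_ge0 //.
by apply: le_trans (cabsD _ _) _; rewrite cabsN cabs_nat -natr1 lerD2l frac1.
Qed.

Let e1_ge n : (n <= e1 n)%N.
Proof. by rewrite /e1 (leq_trans (leq_pmulr n T0)) // leq_addr. Qed.

Let e2_ge n : (n <= e2 n)%N.
Proof.
case: n => // n; rewrite /e2 mulSn -addnBAC ?(ltnW jT) //.
by rewrite -add1n leq_add ?subn_gt0 // leq_pmulr.
Qed.

Let lamV1 : cabs lam^-1 = 1. Proof. by rewrite cabsV lam1 invr1. Qed.

Let L1 k := lambert (c1 k) lam e1.
Let L2 k := lambert (c2 k) lam^-1 e2.
(** The term n = 0 of the first sum when j = 0: its exponent of q is zero, so it is the constant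
    that [lambert] leaves out. *)
Let K0 k : C := if j == 0%N then lam * 0 ^+ k / (1 - lam) else 0.

Lemma QcoefE k r : Qcoef T j lam k.+1 r =
  (k`!)%:R^-1 * (L1 k r + delta (K0 k) r) + (-1) ^+ k.+1 / (k`!)%:R * L2 k r
  + delta (- (bernp k.+1 (j%:R / T%:R) / (k.+1`!)%:R)) r.
Proof.
rewrite /Qcoef; congr (_ * (_ + _) + _ * _ + _).
- rewrite /delta /K0; case: (r == 0%N); last by rewrite mul0r.
  by rewrite mul1r; case: (j == 0%N).
- rewrite /L2 /lambert; apply: eq_bigr => m _; apply: eq_bigr => n _.
  rewrite exprVn; set b1 := [&& _, _ & _]; set b2 := [&& _, _ & _].
  (* The guards [0 < n] and [0 < r] agree: for m > 0 the range m <= r forces r > 0, and n = 0 would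
     make the exponent 0. *)
  have -> : b1 = b2; last by [].
  rewrite /b1 /b2 /e2; case: m {b1 b2} => m mr /=; case: n => n nr /=.
  case: r mr nr => [|r] mr nr; first by move: mr; case: m.
  by case: n nr => // nr; rewrite mul0n sub0n muln0 !andbF.
- by rewrite /delta mulrN mulrA.
Qed.

Let L1_subexp k : subexp (L1 k).
Proof. exact: (lambert_subexp _ lam1 (c1_poly k)). Qed.
Let L2_subexp k : subexp (L2 k).
Proof. exact: (lambert_subexp _ lamV1 (c2_poly k)). Qed.

Lemma subexp_Qcoef k : subexp (Qcoef T j lam k).
Proof.
case: k => [|k].
  apply: subexp_le (subexp_delta (-1)) => n.
  by rewrite /Qcoef /delta mulrN1.
apply: (@subexp_le _ _ (fun r =>  (k`!)%:R^-1 * (L1 k r + delta (K0 k) r) + (-1) ^+ k.+1 / (k`!)%:R * L2 k r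
  + delta (- (bernp k.+1 (j%:R / T%:R) / (k.+1`!)%:R)) r)) => [n|].
  by rewrite QcoefE.
apply: subexpD (subexp_delta _); apply: subexpD (subexpZ _ (L2_subexp k)).
exact: subexpZ _ (subexpD (L1_subexp k) (subexp_delta _)).
Qed.

Lemma csum_lambert1 k :
  csum (fun n => let x := n%:R + j%:R / T%:R in
                 lam * x ^+ k * qpow x tau / (1 - lam * qpow x tau)) = psum (L1 k) z + K0 k.
Proof.
set v := (fun n : nat => _).
apply: csum_cvg_eq.
have H := lambert_cvg lam1 z1 e1_ge (c1_poly k).
set u := (fun n => if _ then _ else _) in H.
have -> : series v = (fun N => series u N + series (delta (K0 k)) N).
  apply/funext => N; rewrite !seriesEnat /= -big_split /=; apply: eq_bigr => n _.
  rewrite /v /u /c1.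
  have -> : (n%:R + j%:R / T%:R : C) = (e1 n)%:R / T%:R.
    by rewrite natrD natrM mulrDl mulfK // natC_neq0.
  rewrite qpow_level; case: eqP => [|/eqP en].
    rewrite /e1 /delta /K0 => /eqP; rewrite addn_eq0 muln_eq0 => /andP[].
    rewrite [T == 0%N]eqn0Ngt T0 orbF => /eqP -> /eqP ->.
    by rewrite eqxx mul0n /= mul0r expr0 !mulr1 mul1r add0r.
  have -> : delta (K0 k) n = 0.
    move: en; rewrite /e1 /delta /K0; case: n => [|n] /=; last by rewrite mul0r.
    by rewrite mul0n add0n => /negPf ->; rewrite mulr0.
  by rewrite addr0; ring.
by apply: cvgD H _; exact: series_delta.
Qed.

Lemma csum_lambert2 k :
  csum (fun n => let y := n.+1%:R - j%:R / T%:R in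
                 lam^-1 * y ^+ k * qpow y tau / (1 - lam^-1 * qpow y tau)) = psum (L2 k) z.
Proof.
set v := (fun n : nat => _).
apply: csum_cvg_eq.
have H := lambert_cvg lamV1 z1 e2_ge (c2_poly k).
set u := (fun n => if _ then _ else _) in H.
have -> : series v = (fun N => series u N.+1).
  apply/funext => N; rewrite !seriesEnat /= !big_mkord big_ord_recl.
  rewrite {1}/u /e2 mul0n sub0n eqxx add0r.
  apply: eq_bigr => n _; rewrite /v /u lift0 /c2.
  have jn : (j < n.+1 * T)%N by rewrite (leq_trans jT) // leq_pmull.
  have -> : (n.+1%:R - j%:R / T%:R : C) = (e2 n.+1)%:R / T%:R.
    by rewrite natrB ?(ltnW jn) // natrM mulrBl mulfK // natC_neq0.
  rewrite qpow_level; case: eqP => [|/eqP en].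
    by rewrite /e2 => /eqP; rewrite subn_eq0 leqNgt jn.
  by ring.
by rewrite (cvg_shiftS (series u)).
Qed.

Lemma Qfun_psum k : Qfun T j lam k tau = psum (Qcoef T j lam k) z.
Proof.
case: k => [|k].
  rewrite /Qfun -[LHS](psum_delta (-1) z); apply: eq_psum => n.
  by rewrite /Qcoef /delta mulrN1.
have hd := @subexp_delta; have h2 := subexpZ ((-1) ^+ k.+1 / (k`!)%:R) (L2_subexp k).
have h1 := subexpD (L1_subexp k) (hd (K0 k)); have h1' := subexpZ ((k`!)%:R^-1) h1.
rewrite (eq_psum z (QcoefE k)) (psumD (subexpD h1' h2) (hd _) z1) (psumD h1' h2 z1).
rewrite psum_delta (psumZ _ h1 z1) (psumZ _ (L2_subexp k) z1) (psumD (L1_subexp k) (hd _) z1).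
by rewrite psum_delta /Qfun csum_lambert1 csum_lambert2.
Qed.

End Level.
End QExpansions.

(** * Formal series in q as a module over the convergent power series, and growth of solutions of
    the system *)

Section FormalSeries.
Variable R : realType.
Local Notation C := (CC R).
Variable T : nat.
Hypothesis T0 : (0 < T)%N.
Implicit Types (a : fser R) (f g : nat -> C) (mu lam : C).

Let TC : (T%:R : C) != 0. Proof. exact: natC_neq0. Qed.

Lemma csum_fin (u : nat -> C) K : (forall r, (K <= r)%N -> u r = 0) -> csum u = \sum_(r < K) u r.
Proof.
move=> H; apply: csum_cvg_eq; apply/cvg_ballP => e e0; exists K => // n /= Kn.
rewrite seriesEnat /= big_mkord (@sum_widen _ u K n) //; first exact: ballxx.
by move=> i Ki _; exact: H.
Qed.

(** The condition that makes [fmul] a finite sum at each exponent. It names no base exponent and is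
    preserved by [fmul]. *)
Definition lfin a := forall mu, exists K, forall r, (K <= r)%N -> a (mu - r%:R / T%:R) = 0.

Lemma fmulE f a mu K : (forall r, (K <= r)%N -> a (mu - r%:R / T%:R) = 0) ->
  fmul T f a mu = \sum_(r < K) f r * a (mu - r%:R / T%:R).
Proof.
by move=> H; rewrite /fmul; apply: csum_fin => r Kr; rewrite H // mulr0.
Qed.

Definition supp_from lam a := forall mu, a mu != 0 -> exists n : nat, mu = lam + n%:R / T%:R.

Lemma divT_inj (m n : nat) : (m%:R / T%:R : C) = n%:R / T%:R -> m = n.
Proof. by move/(mulIf (invr_neq0 TC)) => /eqP; rewrite eqr_nat => /eqP. Qed.

Lemma supp_from_lfin lam a : supp_from lam a -> lfin a.
Proof.
move=> ga mu; have [[n n0]|H] := pselect (exists n : nat, mu = lam + n%:R / T%:R).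
  exists n.+1 => r nr; apply/eqP; apply: contraT => /ga[k E]; exfalso.
  have : (n%:R / T%:R : C) = (k + r)%:R / T%:R.
    by rewrite natrD mulrDl; move: E; rewrite n0 => /(canRL (subrK _)); rewrite -addrA => /addrI.
  by move/divT_inj => E'; move: nr; rewrite E' ltnNge leq_addl.
have [[r0 Hr0]|H'] := pselect (exists r : nat, a (mu - r%:R / T%:R) != 0); last first.
  by exists 0%N => r _; apply/eqP; apply: contraT => h; case: H'; exists r.
have [k E] := ga _ Hr0; exists r0.+1 => r rr; apply/eqP; apply: contraT => /ga[k' E']; exfalso.
have mE : mu = lam + (k%:R + r0%:R) / T%:R.
  by rewrite mulrDl addrA -E subrK.
have [kr|kr] := leqP r0 (k + r0); last by move: kr; rewrite ltnNge leq_addl.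
by apply: H; exists (k + r0)%N; rewrite natrD.
Qed.

Lemma subT mu s r : mu - s%:R / T%:R - r%:R / T%:R = mu - (s + r)%:R / T%:R :> C.
Proof. by rewrite natrD mulrDl opprD addrA. Qed.

Lemma lfin_fmul f a : lfin a -> lfin (fmul T f a).
Proof.
move=> la mu; have [K HK] := la mu; exists K => s Ks.
rewrite (@fmulE _ _ _ 0) ?big_ord0 // => r _; rewrite subT HK //.
exact: leq_trans Ks (leq_addr _ _).
Qed.

Lemma fmulA f g a mu : lfin a -> fmul T f (fmul T g a) mu = fmul T (ps_mul f g) a mu.
Proof.
move=> la; have [K HK] := la mu.
rewrite (@fmulE _ _ _ K) => [|s Ks]; last first.
  by rewrite (@fmulE _ _ _ 0) ?big_ord0 // => r _; rewrite subT HK // (leq_trans Ks) // leq_addr.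
rewrite (@fmulE _ _ _ K) //.
have -> : \sum_(s < K) f s * fmul T g a (mu - s%:R / T%:R) =
  \sum_(s < K) \sum_(r < K) f s * (g r * a (mu - (s + r)%:R / T%:R)).
  apply: eq_bigr => s _; rewrite (@fmulE _ _ _ K) => [|r Kr].
    by rewrite mulr_sumr; apply: eq_bigr => r _; rewrite subT.
  by rewrite subT HK // (leq_trans Kr) // leq_addl.
rewrite (square_sum (fun s r => f s * (g r * a (mu - (s + r)%:R / T%:R)))).
rewrite [X in _ + X]big1 ?addr0.
  apply: eq_bigr => n _; rewrite /ps_mul mulr_suml; apply: eq_bigr => i _.
  by rewrite subnKC ?mulrA // -ltnS.
move=> i _; rewrite big_nat big1 // => j /andP[j1 _].
by rewrite HK ?mulr0 // -leq_subLR.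
Qed.

Lemma fmul_lin (c : C) f g a mu : lfin a ->
  fmul T (fun n => c * f n + g n) a mu = c * fmul T f a mu + fmul T g a mu.
Proof.
move=> la; have [K HK] := la mu; rewrite !(@fmulE _ _ _ K) // mulr_sumr -big_split /=.
by apply: eq_bigr => r _; rewrite mulrDl mulrA.
Qed.

Lemma fmul_sum N (k : nat -> C) (b : nat -> fser R) f mu : (forall i, lfin (b i)) ->
  fmul T f (fun nu => \sum_(i < N) k i * b i nu) mu = \sum_(i < N) k i * fmul T f (b i) mu.
Proof.
move=> lb; elim: N => [|N IH].
  by rewrite big_ord0 (@fmulE _ _ _ 0) ?big_ord0 // => r _; rewrite big_ord0.
have [K HK] : exists K, (forall r, (K <= r)%N ->
    b N (mu - r%:R / T%:R) = 0 /\ \sum_(i < N) k i * b i (mu - r%:R / T%:R) = 0).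
  have [K1 H1] := lb N mu.
  suff [K2 H2] : exists K, forall r, (K <= r)%N -> \sum_(i < N) k i * b i (mu - r%:R / T%:R) = 0.
    by exists (maxn K1 K2) => r; rewrite geq_max => /andP[? ?]; rewrite H1 // H2.
  elim: N {IH H1} => [|N [K HK]]; first by exists 0%N => r _; rewrite big_ord0.
  have [K' HK'] := lb N mu; exists (maxn K K') => r; rewrite geq_max => /andP[? ?].
  by rewrite big_ord_recr /= HK // HK' // mulr0 addr0.
rewrite big_ord_recr /= -IH (@fmulE _ _ _ K) => [|r Kr]; last first.
  by have [h1 h2] := HK r Kr; rewrite big_ord_recr /= h1 h2 mulr0 addr0.
rewrite (@fmulE _ _ _ K) => [|r /HK[_ ->]] //.
rewrite (@fmulE _ _ _ K) => [|r /HK[-> _]] //.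
rewrite mulr_sumr -big_split /=; apply: eq_bigr => r _.
by rewrite big_ord_recr /= mulrDr; congr (_ + _); rewrite mulrCA.
Qed.

Section Span.
Variables (N : nat) (b : nat -> fser R).
Hypothesis lb : forall i, lfin (b i).

(** Membership in the A-module generated by b_0, ..., b_(N-1), where A consists of the [subexp]
    sequences under [ps_mul]. *)
Definition inspan a := exists f : nat -> nat -> C,
  (forall i, subexp (f i)) /\ forall mu, a mu = \sum_(i < N) fmul T (f i) (b i) mu.

Lemma inspan_ext a a' : a =1 a' -> inspan a -> inspan a'.
Proof. by move=> E [f [Hf H]]; exists f; split=> // mu; rewrite -E. Qed.

Lemma inspan_lin (c : C) a a' : inspan a -> inspan a' -> inspan (fun mu => c * a mu + a' mu).
Proof.
move=> [f [Hf H]] [g [Hg H']]; exists (fun i n => c * f i n + g i n); split.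
  by move=> i; exact: subexpD (subexpZ c (Hf i)) (Hg i).
move=> mu; rewrite H H' mulr_sumr -big_split /=; apply: eq_bigr => i _.
by rewrite fmul_lin.
Qed.

Lemma inspan0 : inspan (fun=> 0).
Proof.
exists (fun _ => delta 0); split=> [i|mu]; first exact: subexp_delta.
rewrite big1 // => i _; rewrite /fmul (@csum_fin _ 0) ?big_ord0 // => r _.
by rewrite /delta mulr0 mul0r.
Qed.

Lemma inspan_gen i : (i < N)%N -> inspan (b i).
Proof.
move=> iN; exists (fun k => delta (k == i)%:R); split=> [k|mu]; first exact: subexp_delta.
have E k : fmul T (delta (k == i)%:R) (b k) mu = (k == i)%:R * b k mu.
  rewrite /fmul (@csum_fin _ 1) => [|r r0].
    by rewrite big_ord1 /delta eqxx mul1r mul0r subr0.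
  by rewrite /delta eqn0Ngt r0 !mul0r.
rewrite (bigD1 (Ordinal iN)) //= E eqxx mul1r big1 ?addr0 // => k kE.
by rewrite E; case: eqP => [kE'|]; [case/eqP: kE; apply: val_inj | rewrite mul0r].
Qed.

Lemma inspan_fmul g a : subexp g -> inspan a -> inspan (fmul T g a).
Proof.
move=> Hg [f [Hf H]]; exists (fun i => ps_mul g (f i)); split.
  by move=> i; exact: subexpM Hg (Hf i).
move=> mu; have -> : a = (fun nu => \sum_(i < N) 1 * fmul T (f i) (b i) nu).
  by apply/funext => nu; rewrite H; apply: eq_bigr => i _; rewrite mul1r.
rewrite (@fmul_sum N (fun=> 1) (fun i => fmul T (f i) (b i))); last first.
  by move=> i; exact: lfin_fmul.
by apply: eq_bigr => i _; rewrite mul1r fmulA.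
Qed.

Lemma inspan_sum (I : Type) (s : seq I) (P : pred I) (F : I -> fser R) :
  (forall i, P i -> inspan (F i)) -> inspan (fun mu => \sum_(i <- s | P i) F i mu).
Proof.
move=> H; elim: s => [|i s IH].
  by apply: inspan_ext inspan0 => mu; rewrite big_nil.
have [Pi|nPi] := boolP (P i).
  apply: inspan_ext (inspan_lin 1 (H i Pi) IH) => mu; by rewrite big_cons Pi mul1r.
by apply: inspan_ext IH => mu; rewrite big_cons (negPf nPi).
Qed.

Lemma inspanZ (c : C) a : inspan a -> inspan (fun mu => c * a mu).
Proof. by move=> H; apply: inspan_ext (inspan_lin c H inspan0) => mu; rewrite addr0. Qed.

End Span.

(** Let M bound the sums of phi_i r^i. Once n/t - A - phi_0 >= M + 1, the recursion makes s_n r^n at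
    most M/(M+1) times a bound for the earlier terms, so the terms below [n0] control all others.
    Below [n0], where n/t - A may be zero or negative, the recursion is not consulted. *)
Lemma recursion_rsub (s phi : nat -> R) (t A : R) : 0 < t ->
  (forall n, 0 <= s n) -> (forall n, 0 <= phi n) -> rsubexp phi ->
  (forall n, (n%:R / t - A) * s n <= \sum_(i < n.+1) phi i * s (n - i)%N) -> rsubexp s.
Proof.
move=> t0 s0 p0 Hp rec; apply: rsubexp_bounded => r r01; have [r0 r1] := andP r01.
have [M HM] := Hp r r01.
have M0 : 0 <= M by have := HM 0%N; rewrite big_ord0.
(* Solves n/t - A - phi_0 = M + 1 for n. *)
pose X := t * (A + phi 0%N + M + 1).
pose n0 := Num.bound `|X|.
have Hn0 n : (n0 <= n)%N -> M + 1 <= n%:R / t - A - phi 0%N.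
  move=> nn; suff : A + phi 0%N + M + 1 <= n%:R / t by lra.
  rewrite ler_pdivlMr // mulrC; apply: le_trans (_ : n0%:R <= _); last by rewrite ler_nat.
  by apply: ltW; apply: le_lt_trans (ler_norm _) _; exact: archi_boundP (normr_ge0 X).
pose K := \sum_(i < n0) s i * r ^+ i.
have sr i : 0 <= s i * r ^+ i by rewrite mulr_ge0 ?exprn_ge0.
have K0 : 0 <= K by apply: sumr_ge0.
exists K => n; have [m] := ubnP n; elim: m n => // m IH n; rewrite ltnS => nm.
have [nn|nn] := ltnP n n0.
  by rewrite /K (bigD1 (Ordinal nn)) //= lerDl sumr_ge0.
(* The summand phi_0 s_n also contains the unknown; it is split off here and moved to the left
   below. *)
have H := rec n; rewrite big_ord_recl subn0 in H.
have H1 : (M + 1) * (s n * r ^+ n) <= M * K.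
  apply: le_trans (_ : (n%:R / t - A - phi 0%N) * (s n * r ^+ n) <= _).
    by rewrite ler_wpM2r // Hn0.
  apply: le_trans (_ : (\sum_(i < n) phi (lift ord0 i) * s (n - lift ord0 i)%N) * r ^+ n <= _).
    by rewrite mulrA ler_wpM2r ?exprn_ge0 // mulrBl lerBlDl.
  apply: le_trans (ler_wpM2r K0 (HM n.+1)); rewrite big_ord_recl mulrDl.
  apply: ler_wpDl; first by rewrite !mulr_ge0 ?exprn_ge0.
  rewrite !mulr_suml; apply: ler_sum => i _; rewrite lift0.
  have -> : r ^+ n = r ^+ i.+1 * r ^+ (n - i.+1) by rewrite -exprD subnKC.
  rewrite mulrACA ler_wpM2l ?mulr_ge0 ?exprn_ge0 // IH // (leq_trans _ nm) // ltn_subrL /=.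
  exact: leq_ltn_trans (ltn_ord i).
apply: contraTT H1; rewrite -!ltNge => H2.
apply: le_lt_trans (_ : M * (s n * r ^+ n) < _); first by rewrite ler_wpM2l // ltW.
by rewrite ltr_pM2r ?ltrDl // (le_lt_trans K0).
Qed.

Lemma supp_from_shift_val lam a n r : supp_from lam a -> (n < r)%N -> a (lam + n%:R / T%:R - r%:R / T%:R) = 0.
Proof.
move=> ga nr; apply/eqP; apply: contraT => /ga[k E]; exfalso.
have : (n%:R / T%:R : C) = (k + r)%:R / T%:R.
  by rewrite natrD mulrDl; move: E => /(canRL (subrK _)); rewrite -addrA => /addrI.
by move/divT_inj => E'; move: nr; rewrite E' ltnNge leq_addl.
Qed.

Definition cseq lam a : nat -> C := fun n => a (lam + n%:R / T%:R).

Lemma cseq_fmul lam f a n : supp_from lam a -> cseq lam (fmul T f a) n = ps_mul f (cseq lam a) n.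
Proof.
move=> ga; rewrite /cseq (@fmulE _ _ _ n.+1); last by move=> r; exact: supp_from_shift_val.
rewrite /ps_mul; apply: eq_bigr => r _; congr (_ * a _).
by rewrite natrB; [rewrite mulrBl addrA | rewrite -ltnS].
Qed.

(** Summing the moduli of the n-th coefficients over all generators turns the system into one scalar
    recursion, with phi_r the sum of all |f_ij| at r and |lam + n/T| >= n/T - |lam|. *)
Lemma ode_subexp N (b : nat -> fser R) (f : nat -> nat -> nat -> C) lam :
  (forall i, supp_from lam (b i)) -> (forall i j, subexp (f i j)) ->
  (forall i mu, (i < N)%N -> fder (b i) mu = \sum_(j < N) fmul T (f i j) (b j) mu) ->
  forall i, (i < N)%N -> subexp (cseq lam (b i)).
Proof.
move=> gb Hf ode i0 i0N.
pose x i n := cabs (cseq lam (b i) n).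
pose s n := \sum_(i < N) x i n.
pose phi r := \sum_(i < N) \sum_(j < N) cabs (f i j r).
have x0 i n : 0 <= x i n by exact: cabs_ge0.
have s0 n : 0 <= s n by apply: sumr_ge0.
have xs i n : (i < N)%N -> x i n <= s n.
  by move=> iN; rewrite /s (bigD1 (Ordinal iN)) //= lerDl sumr_ge0.
suff : rsubexp s by apply: rsubexp_le => n; exact: xs.
have Hphi : rsubexp phi.
  have S (h : nat -> nat -> R) m : (forall i, rsubexp (h i)) -> rsubexp (fun r => \sum_(i < m) h i r).
    move=> Hh; elim: m => [|m IH].
      by apply: rsubexp_le (rsubexp_cst 0) => n; rewrite big_ord0.
    by apply: rsubexp_le (rsubexpD IH (Hh m)) => n; rewrite big_ord_recr.
  by apply: (S (fun i r => \sum_(j < N) cabs (f i j r))) => i;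
     apply: (S (fun j r => cabs (f i j r))) => j; exact: Hf.
have t0 : (0 : R) < T%:R by rewrite ltr0n.
apply: (recursion_rsub (A := cabs lam) t0 s0 _ Hphi) => [n|n].
  by apply: sumr_ge0 => i _; apply: sumr_ge0 => j _; exact: cabs_ge0.
rewrite /s mulr_sumr.
have key i : (i < N)%N -> (n%:R / T%:R - cabs lam) * x i n <=
    \sum_(r < n.+1) \sum_(j < N) cabs (f i j r) * s (n - r)%N.
  move=> iN; apply: le_trans (_ : cabs (lam + n%:R / T%:R) * x i n <= _).
    rewrite ler_wpM2r // addrC; have := cabs_leD (n%:R / T%:R) lam.
    by rewrite cabsM cabsV !cabs_nat addrC [n%:R / _ + lam]addrC.
  have := ode i (lam + n%:R / T%:R) iN; rewrite /fder => E.
  rewrite -cabsM [X in cabs X]E exchange_big /=.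
  apply: le_trans (cabs_sum _ _ _) _; apply: ler_sum => j _.
  rewrite -/(cseq lam (fmul T (f i j) (b j)) n) cseq_fmul // /ps_mul.
  apply: le_trans (cabs_sum _ _ _) _; apply: ler_sum => r _.
  by rewrite cabsM ler_wpM2l ?cabs_ge0 // xs.
apply: le_trans (_ : \sum_(i < N) \sum_(r < n.+1) \sum_(j < N) cabs (f i j r) * s (n - r)%N <= _).
  by apply: ler_sum => i _; exact: key.
rewrite exchange_big /=; apply: ler_sum => r _; rewrite /phi mulr_suml.
by apply: ler_sum => i _; rewrite mulr_suml.
Qed.

End FormalSeries.

(** * Evaluation of formal series on the upper half-plane *)

Section Evaluation.
Variable R : realType.
Local Notation C := (CC R).
Variable T : nat.
Hypothesis T0 : (0 < T)%N.
Implicit Types (a : fser R) (f : nat -> C) (mu lam tau : C).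
Local Notation supp_from := (supp_from T).
Local Notation cseq := (cseq T).
Local Notation nome tau := (qpow (T%:R^-1) tau).

Let TC : (T%:R : C) != 0. Proof. exact: natC_neq0. Qed.

Definition ev lam a tau : C := qpow lam tau * psum (cseq lam a) (nome tau).

Lemma ev_term lam a tau n :
  a (lam + n%:R / T%:R) * qpow (lam + n%:R / T%:R) tau
    = qpow lam tau * (cseq lam a n * nome tau ^+ n).
Proof. by rewrite qpowD qpow_natM /cseq; ring. Qed.

Lemma ev_cvg lam a tau : subexp (cseq lam a) -> 0 < cIm tau ->
  series (fun n => a (lam + n%:R / T%:R) * qpow (lam + n%:R / T%:R) tau) @ \oo --> ev lam a tau.
Proof.
move=> Ha t0.
have -> : series (fun n => a (lam + n%:R / T%:R) * qpow (lam + n%:R / T%:R) tau) =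
  (fun N => qpow lam tau * series (fun n => cseq lam a n * nome tau ^+ n) N).
  apply/funext => N; rewrite !seriesEnat /= mulr_sumr; apply: eq_bigr => n _.
  exact: ev_term.
apply: cvgM; first exact: cvg_cst.
exact: psum_cvg Ha (cabs_qpow T0 t0).
Qed.

Lemma ev_lin lam (c : C) a b e tau : (forall mu, e mu = c * a mu + b mu) ->
  subexp (cseq lam a) -> subexp (cseq lam b) -> 0 < cIm tau ->
  ev lam e tau = c * ev lam a tau + ev lam b tau.
Proof.
move=> E Ha Hb t0; rewrite /ev.
rewrite (eq_psum (b := fun n => c * cseq lam a n + cseq lam b n)) => [|n]; last exact: E.
rewrite (psumD (subexpZ c Ha) Hb (cabs_qpow T0 t0)) (psumZ c Ha (cabs_qpow T0 t0)).
by rewrite mulrDr mulrCA.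
Qed.

Lemma ev_fmul lam f a tau : supp_from lam a -> subexp f -> subexp (cseq lam a) -> 0 < cIm tau ->
  ev lam (fmul T f a) tau = psum f (nome tau) * ev lam a tau.
Proof.
move=> ga Hf Ha t0; rewrite /ev.
rewrite (eq_psum (b := ps_mul f (cseq lam a))) => [|n]; last exact: cseq_fmul.
by rewrite (psumM Hf Ha (cabs_qpow T0 t0)) mulrCA.
Qed.

Lemma supp_from_fmul lam f a : supp_from lam a -> supp_from lam (fmul T f a).
Proof.
move=> ga mu; apply: contraPP => H; apply/negP; rewrite negbK; apply/eqP.
rewrite (@fmulE _ _ _ _ _ 0) ?big_ord0 // => r _; apply/eqP; apply: contraT => /ga[k E].
exfalso; apply: H; exists (k + r)%N.
by rewrite natrD mulrDl addrA -E subrK.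
Qed.

Lemma supp_from_lin lam (c : C) a b e : (forall mu, e mu = c * a mu + b mu) ->
  supp_from lam a -> supp_from lam b -> supp_from lam e.
Proof.
move=> E ga gb mu; have [b0|/gb //] := eqVneq (b mu) 0.
have [a0|/ga //] := eqVneq (a mu) 0.
by rewrite E a0 b0 mulr0 addr0 eqxx.
Qed.

Lemma subexp_cseq_fmul lam f a : supp_from lam a -> subexp f -> subexp (cseq lam a) ->
  subexp (cseq lam (fmul T f a)).
Proof.
by move=> ga Hf Ha; apply: subexp_le (subexpM Hf Ha) => n; rewrite cseq_fmul.
Qed.

(** Multiplication by the variable. It appears when the base exponent is lowered by 1/T, and in the
    Euler operator z d/dz behind q d/dq. *)
Definition shiftr1 (u : nat -> C) : nat -> C := fun n => if n is n'.+1 then u n' else 0.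

Lemma subexp_shiftr1 u : subexp u -> subexp (shiftr1 u).
Proof.
move=> Hu r r01; have [M HM] := Hu r r01; exists M => -[|N].
  by have := HM 0%N; rewrite !big_ord0.
rewrite big_ord_recl cabs0 mul0r add0r; apply: le_trans (HM N).
apply: ler_sum => i _; rewrite lift0 ler_wpM2l ?cabs_ge0 //.
by rewrite exprS ler_piMl ?exprn_ge0 //; case/andP: r01 => // _ /ltW.
Qed.

Lemma psum_shiftr1 u z : subexp u -> cabs z < 1 -> psum (shiftr1 u) z = z * psum u z.
Proof.
move=> Hu z1; apply: psumP; rewrite -(cvg_shiftS (series _)).
have -> : (fun N => series (fun n => shiftr1 u n * z ^+ n) N.+1) =
   (fun N => z * series (fun n => u n * z ^+ n) N).
  apply/funext => N; rewrite !psum_partial big_ord_recl /= mul0r add0r mulr_sumr.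
  by apply: eq_bigr => i _; rewrite /bump add1n exprS; ring.
by apply: cvgM; [exact: cvg_cst | exact: psum_cvg Hu z1].
Qed.

Lemma supp_from_shift lam a m : supp_from lam a -> supp_from (lam - m%:R / T%:R) a.
Proof.
move=> ga mu /ga[n ->]; exists (m + n)%N.
by rewrite natrD mulrDl addrA subrK.
Qed.

Lemma cseq_shift1 lam a n : supp_from lam a -> cseq (lam - 1 / T%:R) a n = shiftr1 (cseq lam a) n.
Proof.
move=> ga; rewrite /cseq; case: n => [|n] /=.
  have := @supp_from_shift_val _ _ T0 lam a 0 1 ga isT.
  by rewrite !mul0r !addr0.
by congr a; rewrite -natr1 mulrDl; ring.
Qed.

Lemma ev_shift lam a m tau : supp_from lam a -> subexp (cseq lam a) -> 0 < cIm tau ->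
  subexp (cseq (lam - m%:R / T%:R) a) /\ ev (lam - m%:R / T%:R) a tau = ev lam a tau.
Proof.
move=> ga Ha t0; elim: m => [|m [IH IH']]; first by rewrite mul0r subr0.
have -> : lam - m.+1%:R / T%:R = lam - m%:R / T%:R - 1 / T%:R by rewrite -natr1 mulrDl; ring.
have gm := supp_from_shift m ga.
split; first by apply: subexp_le (subexp_shiftr1 IH) => n; rewrite cseq_shift1.
rewrite -IH' /ev (eq_psum (b := shiftr1 (cseq (lam - m%:R / T%:R) a))) => [|n]; last first.
  exact: cseq_shift1.
rewrite (psum_shiftr1 IH (cabs_qpow T0 t0)) mulrA -qpowD; congr (qpow _ tau * _).
by rewrite mul1r subrK.
Qed.

(** A nonzero series has an exponent lying above both bases, so these differ by an integer multiple
    of 1/T and [ev_shift] compares them. The zero series has value 0 at any base. *)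
Lemma ev_indep lam lam' a tau : supp_from lam a -> supp_from lam' a ->
  subexp (cseq lam a) -> subexp (cseq lam' a) -> 0 < cIm tau -> ev lam a tau = ev lam' a tau.
Proof.
move=> ga ga' Ha Ha' t0; have [[mu amu]|H] := pselect (exists mu, a mu != 0); last first.
  have a0 mu : a mu = 0 by apply/eqP; apply: contraT => h; case: H; exists mu.
  have Z l : ev l a tau = 0.
    rewrite /ev (eq_psum (b := delta 0)) ?psum_delta ?mulr0 // => n.
    by rewrite /cseq a0 /delta mulr0.
  by rewrite !Z.
have [n En] := ga _ amu; have [n' En'] := ga' _ amu.
wlog nn : lam lam' n n' ga ga' Ha Ha' En En' / (n <= n')%N.
  move=> W; have [|/ltnW] := leqP n n'; first exact: (W lam lam').
  by move=> nn; apply/esym; apply: (W lam' lam n' n).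
have -> : lam' = lam - (n' - n)%:R / T%:R.
  by apply: (addIr (n'%:R / T%:R)); rewrite -En' En natrB // mulrBl; ring.
by rewrite (ev_shift _ ga Ha t0).2.
Qed.

Lemma is_derive_ev lam a tau : supp_from lam a -> subexp (cseq lam a) -> 0 < cIm tau ->
  is_derive tau 1 (ev lam a) (@twopii R * ev lam (fder a) tau).
Proof.
move=> ga Ha t0; have z1 := cabs_qpow T0 t0.
have D1 := is_derive_qpow lam tau.
have D2 := is_derive_compC (is_derive_psum Ha z1) (is_derive_qpow (T%:R^-1) tau).
have D := is_deriveM D1 D2.
apply: is_derive_eq D _.
rewrite -[_ *: _]/(_ * _) -[X in _ + X]/(_ * _) /=.
have hd := subexp_shiftr1 (subexp_dseq Ha).
have -> : ev lam (fder a) tau = qpow lam tau * (lam * psum (cseq lam a) (nome tau)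
   + T%:R^-1 * (nome tau * psum (dseq (cseq lam a)) (nome tau))).
  rewrite /ev; congr (_ * _).
  rewrite -(psum_shiftr1 (subexp_dseq Ha) z1) -(psumZ _ Ha z1) -(psumZ _ hd z1).
  rewrite -(psumD (subexpZ lam Ha) (subexpZ _ hd) z1).
  apply: eq_psum => -[|n]; rewrite /cseq /fder /=; first by rewrite mul0r mulr0 !addr0.
  by rewrite /dseq /cseq mulrDl mulrA [_^-1 * _]mulrC.
by ring.
Qed.

End Evaluation.

(** * Linear maps and eigenprojections of a map of finite order *)

Section LinearMaps.
Variable R : realType.
Local Notation C := (CC R).
Variables V W : lmodType C.

Definition lin (F : V -> W) := forall (a : C) u w, F (a *: u + w) = a *: F u + F w.
Variable F : V -> W.
Hypothesis HF : lin F.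

Lemma lin0 : F 0 = 0.
Proof. by have := HF (-1) 0 0; rewrite scaler0 addr0 scaleN1r addNr. Qed.

Lemma linZ a u : F (a *: u) = a *: F u.
Proof. by rewrite -[a *: u]addr0 HF lin0 addr0. Qed.

Lemma linD u w : F (u + w) = F u + F w.
Proof. by rewrite -[u]scale1r HF !scale1r. Qed.

Lemma linB u w : F (u - w) = F u - F w.
Proof. by rewrite addrC -scaleN1r HF scaleN1r addrC. Qed.

Lemma lin_sum (I : Type) (s : seq I) (P : pred I) (G : I -> V) :
  F (\sum_(i <- s | P i) G i) = \sum_(i <- s | P i) F (G i).
Proof. exact: (big_morph F linD lin0). Qed.

End LinearMaps.

Section EigenProjections.
Variable R : realType.
Local Notation C := (CC R).
Variables (V : lmodType C) (f : V -> V) (T : nat).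
Hypotheses (lf : lin f) (T0 : (0 < T)%N) (fT : forall v, iter T f v = v).

Local Notation r j := (rootT R T j).

Lemma rootT1X j : r j = r 1 ^+ j.
Proof. by rewrite rootT_X muln1. Qed.

Lemma rootT_period j : r j ^+ T = 1.
Proof. by rewrite rootT1X exprAC (rootT_order _ T0) expr1n. Qed.

Lemma rootT_neq0 j : r j != 0.
Proof.
apply/eqP => E; have := rootT_period j.
by rewrite E expr0n gtn_eqF // mulr0n => /eqP; rewrite eq_sym oner_eq0.
Qed.

(** Averaging over the cyclic group generated by [f] against a character. The eigenvalue is the
    inverse of the root, matching the convention g v = mu^-1 v of [eigen]. *)
Definition eproj j v := (T%:R : C)^-1 *: \sum_(i < T) r j ^+ i *: iter i f v.

Lemma eproj_eigen j v : f (eproj j v) = (r j)^-1 *: eproj j v.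
Proof.
rewrite /eproj (linZ lf) (lin_sum lf) scalerA mulrC -scalerA; congr (_ *: _).
have q0 := rootT_neq0 j; have qn := rootT_period j; move: q0 qn; set q := rootT _ _ _.
case: T T0 fT => // n _ fn q0 qn.
rewrite big_ord_recr big_ord_recl /= scalerDr scaler_sumr addrC; congr (_ + _).
  rewrite (linZ lf) -[f (iter n f v)]/(iter n.+1 f v) fn expr0 scale1r; congr (_ *: _).
  by apply: (mulIf q0); rewrite mulVf // -exprSr.
apply: eq_bigr => i _; rewrite (linZ lf) scalerA /bump leq0n add1n; congr (_ *: _).
by rewrite exprS mulKf.
Qed.

Lemma sum_root i : (0 < i < T)%N -> \sum_(j < T) r j ^+ i = 0 :> C.
Proof.
move=> iT; have q1 := rootT_neq1 R iT.
have -> : \sum_(j < T) r j ^+ i = \sum_(j < T) r i ^+ j.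
  by apply: eq_bigr => j _; rewrite !rootT_X mulnC.
have /eqP : (r i - 1) * (\sum_(j < T) r i ^+ j) = 0 by rewrite -subrX1 rootT_period subrr.
by rewrite mulf_eq0 subr_eq0 (negPf q1) => /eqP.
Qed.

Lemma sum_eproj v : \sum_(j < T) eproj j v = v.
Proof.
rewrite /eproj -scaler_sumr exchange_big /=.
have -> : \sum_(i < T) \sum_(j < T) r j ^+ i *: iter i f v = (T%:R : C) *: v.
  case: T T0 sum_root => // n _ H.
  rewrite big_ord_recl /= [X in _ + X]big1 ?addr0.
    under eq_bigr do rewrite expr0 scale1r.
    by rewrite sumr_const card_ord scaler_nat.
  move=> i _; rewrite -scaler_suml H ?scale0r //.
  by rewrite /bump leq0n add1n; exact: ltn_ord.
by rewrite scalerA mulVf ?scale1r // pnatr_eq0 -lt0n.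
Qed.

(** [eproj] is a polynomial in [f], so it preserves the eigenvectors of any commuting [D]. With [D]
    equal to L(0) or [g] this produces joint eigenvectors. *)
Lemma eproj_comm (D : V -> V) a v j : lin D -> (forall x, D (f x) = f (D x)) -> D v = a *: v ->
  D (eproj j v) = a *: eproj j v.
Proof.
move=> lD Df Dv; rewrite /eproj (linZ lD) (lin_sum lD) scalerA mulrC -scalerA; congr (_ *: _).
rewrite scaler_sumr; apply: eq_bigr => i _; rewrite (linZ lD) scalerA mulrC -scalerA.
congr (_ *: _); elim: (i : nat) => //= m IH; by rewrite Df IH (linZ lf).
Qed.

End EigenProjections.

(** * Weights, modes and decompositions into homogeneous vectors *)

Section Graded.
Variable R : realType.
Local Notation C := (CC R).
Variables (V : lmodType C) (Y : V -> int -> V -> V) (vac om : V) (c : C) (sig : V -> V).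
Hypothesis HV : is_vosa Y vac om c sig.

Local Notation L0 := (L0 Y om).
Local Notation zhu := (zhu Y).
Local Notation Lb := (Lb Y om c).

(** Weights are indexed by their doubles: [om] has index 4, and odd indices are the odd vectors. *)
Definition hwt (n : int) : C := n%:~R / 2%:R.
Definition wt (n : int) (v : V) := L0 v = hwt n *: v.

Lemma Ylin n w : lin (fun u => Y u n w). Proof. by move=> a u1 u2; exact: (Y_linl HV). Qed.
Lemma Ylinr u n : lin (Y u n). Proof. by move=> a u1 u2; exact: (Y_linr HV). Qed.
Lemma L0lin : lin L0. Proof. exact: Ylinr. Qed.

Lemma hwt_inj m n : hwt m = hwt n -> m = n.
Proof.
move/(mulIf (invr_neq0 _)); rewrite pnatr_eq0 => /(_ isT) /eqP.
by rewrite eqr_int => /eqP.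
Qed.

Lemma wt_uniq m n v : wt m v -> wt n v -> m != n -> v = 0.
Proof.
move=> Hm; rewrite /wt Hm => /eqP; rewrite -subr_eq0 -scalerBl scaler_eq0 subr_eq0.
by case/orP => [/eqP/hwt_inj -> |/eqP //]; rewrite eqxx.
Qed.

Lemma wt_lin n a u v : wt n u -> wt n v -> wt n (a *: u + v).
Proof. by rewrite /wt => Hu Hv; rewrite L0lin Hu Hv scalerDr !scalerA mulrC. Qed.

Lemma wt0 n : wt n 0. Proof. by rewrite /wt (lin0 L0lin) scaler0. Qed.
Lemma wtZ n a v : wt n v -> wt n (a *: v).
Proof. by move=> H; rewrite -[a *: v]addr0; apply: wt_lin => //; exact: wt0. Qed.

Lemma wt_om : wt 4 om.
Proof. by rewrite /wt (om_wt HV); congr (_ *: _); rewrite /hwt; field. Qed.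

Lemma wt_par n v : wt n v -> par sig v (odd `|n|%N).
Proof. exact: (L0_parity HV). Qed.

Lemma sig_om : sig om = om.
Proof. by have := wt_par wt_om; rewrite /par /= expr0 scale1r. Qed.

Lemma gbin0 (s : int) : gbin R s 0 = 1.
Proof. by rewrite /gbin big_ord0 fact0 divr1. Qed.

Lemma gbin_nat (m j : nat) : (m < j)%N -> gbin R m j = 0.
Proof. by move=> mj; rewrite /gbin (bigD1 (Ordinal mj)) //= subrr !mul0r. Qed.

Lemma gbin11 : gbin R 1 1 = 1.
Proof. by rewrite /gbin big_ord1 subr0 factS fact0 muln1 divr1. Qed.

(* The commutator formula [L(0), u(n)] = (L(-1)u)(n+1) + (L(0)u)(n), from the
   Jacobi identity with p = 1, q = n, r = 0. *)
Lemma L0_Y p u n w : wt p u ->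
  L0 (Y u n w) = Y u n (L0 w) + (hwt p - n%:~R - 1) *: Y u n w.
Proof.
move=> Hu; have [N HN] := Y_jacobi HV (wt_par wt_om) (wt_par Hu) 1 n 0 w.
pose F (i : nat) := gbin R 1 i *: Y (Y om (0 + i%:Z) u) (1 + n - i%:Z) w.
pose G (i : nat) := ((-1) ^+ i * gbin R 0 i) *: (Y om (1 + 0 - i%:Z) (Y u (n + i%:Z) w)
  - ((-1) ^+ `|0|%N * (-1) ^+ (odd `|4|%N && odd `|p|%N)) *: Y u (n + 0 - i%:Z) (Y om (1 + i%:Z) w)).
(* The length [N.+2] passes the threshold of the Jacobi identity and still contains all nonzero
   terms: i = 0, 1 on the left and i = 0 on the right. *)
have : \sum_(i < N.+2) F i = \sum_(i < N.+2) G i by apply: HN; rewrite ltnW.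
rewrite (@sum_widen _ F 2 N.+2) // => [|i i2 _]; last by rewrite /F gbin_nat ?scale0r.
rewrite (@sum_widen _ G 1 N.+2) // => [|i i1 _]; last by rewrite /G gbin_nat // mulr0 scale0r.
rewrite big_ord_recr !big_ord1 /=.
have -> : F 0%N = Y (Y om 0 u) (n + 1) w.
  by rewrite /F gbin0 scale1r; congr (Y _ _ w); lia.
have -> : F 1%N = Y (L0 u) n w.
  by rewrite /F gbin11 scale1r /L0; congr (Y _ _ w); lia.
have -> : G 0%N = L0 (Y u n w) - Y u n (L0 w).
  rewrite /G gbin0 !expr0 !mul1r !scale1r /L0; congr (Y om _ (Y u _ w) - Y u _ (Y om _ w)); lia.
rewrite (Y_deriv HV) addrK Hu (linZ (Ylin _ _)).
move=> /(canLR (subrK _)) <-; rewrite -scalerDl addrC; congr (_ + _ *: _).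
by rewrite rmorphD /=; ring.
Qed.

(** The usual wt u + wt w - n - 1, in doubled indices. *)
Lemma wtY p q n u w : wt p u -> wt q w -> wt (p + q - 2 * n - 2) (Y u n w).
Proof.
move=> Hu Hw; rewrite /wt (L0_Y _ _ Hu) Hw (linZ (Ylinr _ _)) -scalerDl; congr (_ *: _).
by rewrite /hwt !rmorphB rmorphD rmorphM /=; field.
Qed.

Fixpoint shiftop (l : seq int) (v : V) : V :=
  if l is m :: l' then shiftop l' (L0 v - hwt m *: v) else v.

Lemma shiftop_lin l : lin (shiftop l).
Proof.
elim: l => [|m l IH] a u w //=.
rewrite -IH L0lin; congr (shiftop _ _).
by rewrite !scalerDr !scalerN !scalerA opprD [hwt m * a]mulrC addrACA.
Qed.

Lemma shiftop_wt l n v : wt n v -> shiftop l v = (\prod_(m <- l) (hwt n - hwt m)) *: v.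
Proof.
elim: l v => [|m l IH] v Hv /=; first by rewrite big_nil scale1r.
rewrite Hv -scalerBl IH; last exact: wtZ.
by rewrite scalerA big_cons mulrC.
Qed.

(** The product of L(0) - [hwt m] over the other labels m kills the components of those weights and
    multiplies both [v] and the remaining components by the same nonzero [d]. *)
Lemma wt_component (l : seq (int * V)) n v : (forall y, y \in l -> wt y.1 y.2) -> wt n v ->
  v = \sum_(y <- l) y.2 -> v = \sum_(y <- l | y.1 == n) y.2.
Proof.
move=> Hl Hv E; pose ms := [seq y.1 | y <- l & y.1 != n].
pose d := \prod_(m <- ms) (hwt n - hwt m).
have d0 : d != 0.
  rewrite prodf_seq_neq0; apply/allP => m /mapP[y].
  rewrite mem_filter => /andP[yn _] -> /=; rewrite subr_eq0.
  by apply: contra yn => /eqP/hwt_inj ->.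
apply: (scalerI d0); rewrite -(shiftop_wt ms Hv) {1}E (lin_sum (shiftop_lin ms)).
rewrite (bigID (fun y : int * V => y.1 == n)) /= [X in _ + X]big1_seq => [|y /andP[yn yl]].
  rewrite addr0 scaler_sumr big_seq_cond [RHS]big_seq_cond; apply: eq_bigr => y /andP[yl /eqP yn].
  by rewrite (shiftop_wt _ (Hl y yl)) yn.
rewrite (shiftop_wt _ (Hl y yl)).
suff -> : \prod_(m <- ms) (hwt y.1 - hwt m) = 0 by rewrite scale0r.
apply/eqP; rewrite prodf_seq_eq0; apply/hasP; exists y.1; last by rewrite /= subrr.
by apply/mapP; exists y; rewrite // mem_filter yn yl.
Qed.

(** Finite sums of labelled vectors. Decompositions by weight, by joint eigenvalues and by
    L[0]-eigenvalues all have this form, and [gsum_bind] composes them. *)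
Definition gsum (P : int -> V -> Prop) (v : V) := exists l : seq (int * V),
  v = \sum_(y <- l) y.2 /\ forall y, y \in l -> P y.1 y.2.

Lemma gsum1 (P : int -> V -> Prop) n v : P n v -> gsum P v.
Proof.
move=> H; exists [:: (n, v)]; rewrite big_seq1; split=> // y.
by rewrite inE => /eqP ->.
Qed.

Lemma gsum0 P : gsum P 0.
Proof. by exists [::]; rewrite big_nil. Qed.

Lemma gsumD P u v : gsum P u -> gsum P v -> gsum P (u + v).
Proof.
move=> [l [-> Hl]] [l' [-> Hl']]; exists (l ++ l'); rewrite big_cat; split=> // y.
by rewrite mem_cat => /orP[/Hl|/Hl'].
Qed.

Lemma gsum_bind P Q u : gsum P u -> (forall n v, P n v -> gsum Q v) -> gsum Q u.
Proof.
move=> [l [-> Hl]] H; rewrite big_seq; elim/big_rec: _ => [|y v yl IH]; first exact: gsum0.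
by apply: gsumD => //; apply: H (Hl y yl).
Qed.

Lemma gsumZ P a u : (forall n v, P n v -> P n (a *: v)) -> gsum P u -> gsum P (a *: u).
Proof.
move=> H [l [-> Hl]]; rewrite scaler_sumr big_seq.
elim/big_rec: _ => [|y v yl IH]; first exact: gsum0.
by apply: gsumD => //; apply: gsum1 (H _ _ (Hl y yl)).
Qed.

Lemma gsum_sum P (I : Type) (s : seq I) (G : I -> V) :
  (forall i, gsum P (G i)) -> gsum P (\sum_(i <- s) G i).
Proof. by move=> H; elim/big_rec: _ => [|i v _]; [exact: gsum0 | exact: gsumD]. Qed.

Lemma gsum_wt v : gsum wt v.
Proof. by have [l [E H]] := L0_decomp HV v; exists l; split. Qed.

Lemma Y_vanish u w (n : int) : exists K : nat, forall i : nat, (K <= i)%N -> Y u (n + i%:Z) w = 0.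
Proof.
have [N HN] := Y_trunc HV u w; exists `|N - n|%N => i Ki; apply: HN; lia.
Qed.

(** Any bound beyond which the modes vanish gives the same sum, so the truncation chosen by
    [epsilon] is immaterial. *)
Lemma zhuE u a n w K : (forall i : nat, (K <= i)%N -> Y u (n + i%:Z) w = 0) ->
  zhu u a n w = \sum_(i < K) zcoef a (n + i%:Z) n *: Y u (n + i%:Z) w.
Proof.
move=> HK; rewrite /zhu; set B := `|_|%N.
have HB (i : nat) : (B <= i)%N -> Y u (n + i%:Z) w = 0.
  have := ClassicalEpsilon.epsilon_spec (inhabits (0 : int)) _ (Y_trunc HV u w).
  rewrite -/(trunc_bound Y u w) => H Bi; apply: H; move: Bi; rewrite /B; lia.
pose G (i : nat) := zcoef a (n + i%:Z) n *: Y u (n + i%:Z) w.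
rewrite -(@sum_widen _ G B (B + K)) ?leq_addr //; last by move=> i Bi _; rewrite /G HB // scaler0.
rewrite (@sum_widen _ G K (B + K)) ?leq_addl // => i Ki _; by rewrite /G HK // scaler0.
Qed.

Lemma zcoef_diag (a : C) n : zcoef a n n = 1.
Proof.
rewrite /zcoef subrr absz0 /ps_mul big_ord1 subnn /ps_pow_int big_ord1 /= /ps_exp fact0 expr0 divr1.
by rewrite gbin0 /ps_one eqxx !mul1r.
Qed.

(** u[n] is u(n) plus higher modes, and higher modes have lower weight: this triangularity drives
    every induction on the weight. *)
Lemma zhu_lead u a n w : exists K, zhu u a n w =
  Y u n w + \sum_(i < K) zcoef a (n + i.+1%:Z) n *: Y u (n + i.+1%:Z) w.
Proof.
have [K HK] := Y_vanish u w n; exists K.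
rewrite (zhuE a (K := K.+1)) => [|i Ki]; last by rewrite HK // ltnW.
rewrite big_ord_recl /= addr0 zcoef_diag scale1r; congr (_ + _).
Qed.

Lemma zhu_vanish u a w : exists K : nat, forall n : nat, (K <= n)%N -> zhu u a n%:Z w = 0.
Proof.
have [K HK] := Y_vanish u w 0; exists K => n Kn.
rewrite (zhuE a (K := 0)) ?big_ord0 // => i _.
by have := HK (n + i)%N (leq_trans Kn (leq_addr _ _)); rewrite add0r PoszD.
Qed.

Lemma zhu_linr u a n : lin (zhu u a n).
Proof.
move=> b w w'.
have [K1 H1] := Y_vanish u w n; have [K2 H2] := Y_vanish u w' n.
have [K3 H3] := Y_vanish u (b *: w + w') n.
pose K := maxn K1 (maxn K2 K3).
rewrite !(zhuE a (K := K)) => [|i|i|i]; last first.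
- by rewrite !geq_max => /and3P[h1 h2 h3]; rewrite H3.
- by rewrite !geq_max => /and3P[h1 h2 h3]; rewrite H1.
- by rewrite !geq_max => /and3P[h1 h2 h3]; rewrite H2.
rewrite scaler_sumr -big_split /=; apply: eq_bigr => i _.
by rewrite Ylinr scalerDr !scalerA [b * _]mulrC.
Qed.

Lemma Lb_lin n : lin (Lb n).
Proof.
move=> a u w; rewrite /Defs.Lb zhu_linr scalerDr !scalerDr !scalerN !scalerA mulrC opprD addrACA.
by [].
Qed.

End Graded.

(** * Eigenvector decompositions and reduction modulo the relations in O(g,h) *)

Section Reduction.
Variable R : realType.
Local Notation C := (CC R).
Variables (V : lmodType C) (Y : V -> int -> V -> V) (vac om : V) (c : C) (sig : V -> V).
Hypothesis HV : is_vosa Y vac om c sig.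
Variables (g h : V -> V) (T T1 : nat).
Hypotheses (Hg : is_aut Y vac om g) (Hh : is_aut Y vac om h).
Hypotheses (gT : has_order g T) (hT : has_order h T1) (gh : forall v, g (h v) = h (g v)).

Local Notation L0 := (L0 Y om).
Local Notation zhu := (zhu Y).
Local Notation Lb := (Lb Y om c).
Local Notation wt := (wt Y om).
Local Notation eigen := (eigen Y om sig g h T T1).

Lemma aut_lin f : is_aut Y vac om f -> lin f. Proof. by case. Qed.

Lemma aut_L0 f v : is_aut Y vac om f -> f (L0 v) = L0 (f v).
Proof. by case=> _ _ fY _ fom; rewrite /Defs.L0 fY fom. Qed.

Definition eigP (n : int) (x : V) := wt n x /\
  exists j lam, eigen x (hwt R n) (odd `|n|%N) j lam.

Lemma gsum_eigP n v : wt n v -> gsum (fun k x => k = n /\ eigP k x) v.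
Proof.
move=> Hv; have [T0 gTT _] := gT; have [T10 hTT _] := hT.
have lg := aut_lin Hg; have lh := aut_lin Hh.
rewrite -(sum_eproj g T0 v); apply: gsum_sum => j.
set x := eproj g T j v.
have Hx : wt n x.
  by apply: (eproj_comm T lg _ (L0lin HV)) => // y; rewrite (aut_L0 _ Hg).
rewrite -(sum_eproj h T10 x); apply: gsum_sum => k.
have Hxk : wt n (eproj h T1 k x).
  by apply: (eproj_comm T1 lh _ (L0lin HV)) => // y; rewrite (aut_L0 _ Hh).
apply: (@gsum1 _ _ _ n); split=> //; split=> //; exists j, (rootT R T1 k); split=> //.
- exact: (wt_par HV Hxk).
- by apply: (eproj_comm T1 lh) => //; exact: eproj_eigen.
- by split; [exact: rootT_period | exact: eproj_eigen].
Qed.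

Lemma gsum_eig v : gsum eigP v.
Proof.
apply: (gsum_bind (gsum_wt HV v)) => n x /gsum_eigP H.
by apply: (gsum_bind H) => m y [_ Hy]; exact: (@gsum1 _ _ _ m).
Qed.

Definition stab (v : V) := [/\ sig v = v, g v = v & h v = v].

Lemma siglin : lin sig. Proof. exact: (sig_lin HV). Qed.

Lemma stab_lin a u v : stab u -> stab v -> stab (a *: u + v).
Proof.
move=> [s1 g1 h1] [s2 g2 h2]; split.
- by rewrite siglin s1 s2.
- by rewrite (aut_lin Hg) g1 g2.
- by rewrite (aut_lin Hh) h1 h2.
Qed.

Lemma stab0 : stab 0.
Proof. by split; [exact: lin0 siglin | exact: lin0 (aut_lin Hg) | exact: lin0 (aut_lin Hh)]. Qed.

Lemma stabZ a v : stab v -> stab (a *: v).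
Proof. by move=> H; rewrite -[a *: v]addr0; apply: stab_lin => //; exact: stab0. Qed.

Lemma stab_sum (I : Type) (s : seq I) (P : pred I) (G : I -> V) :
  (forall i, P i -> stab (G i)) -> stab (\sum_(i <- s | P i) G i).
Proof.
move=> H; elim/big_rec: _ => [|i v Pi IH]; first exact: stab0.
by rewrite -[G i]scale1r; apply: stab_lin => //; exact: H.
Qed.

Lemma stab_Yom n v : stab v -> stab (Y om n v).
Proof.
have [_ _ gY _ gom] := Hg; have [_ _ hY _ hom] := Hh.
move=> [s1 g1 h1]; split.
- by rewrite (sig_Y HV) (sig_om HV) s1.
- by rewrite gY gom g1.
- by rewrite hY hom h1.
Qed.

(** L[0]-eigenvectors to which the L[-2] identity applies; the bound on the label records that
    corrections have lower weight. *)
Definition zdiag n0 n (x : V) := [/\ stab x, Lb 0 x = hwt R n *: x & n <= n0].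

Lemma zdiagZ n0 n a x : zdiag n0 n x -> zdiag n0 n (a *: x).
Proof.
move=> [s l nn]; split=> //; first exact: stabZ.
by rewrite (linZ (Lb_lin HV 0)) l !scalerA mulrC.
Qed.

(** L[0] is the mode om[1], and the further modes om(i+2) = L(i+1) lower the weight by i+1. *)
Lemma Lb0_lead n v : wt n v -> exists K (z : nat -> C), Lb 0 v =
  hwt R n *: v + \sum_(i < K) z i *: Y om (i.+2)%:Z v.
Proof.
move=> Hv; have [K E] := zhu_lead HV om 2%:R 1 v.
exists K, (fun i => zcoef 2%:R (1 + i.+1%:Z) 1).
rewrite /Defs.Lb scale0r subr0 add0r E; congr (_ + _); first exact: Hv.
Qed.

(* [L[0] - L(0)] strictly lowers the weight, so [L[0]] is triangular with respect to the
   weight filtration and its eigenvectors are obtained by correcting weight vectors. *)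
Lemma gsum_zdiag v n : wt n v -> stab v -> gsum (zdiag n) v.
Proof.
have [n0 Hn0] := L0_bounded HV.
have : exists m : nat, n < n0 + m%:Z by exists (`|n - n0|%N.+1); lia.
case=> m; elim: m n v => [|m IH] n v nm Hv sv.
  rewrite (Hn0 n v) //; first exact: gsum0.
  by rewrite addr0 in nm.
have [K [z E]] := Lb0_lead Hv.
set r := \sum_(i < K) _ in E.
have [l [Er Hl]] : gsum (zdiag (n - 1)) r.
  rewrite /r; elim: K {r E} => [|K IHK]; first by rewrite big_ord0; exact: gsum0.
  rewrite big_ord_recr; apply: gsumD => //.
  apply: gsumZ => [k x|]; first exact: zdiagZ.
  have Hw : wt (4 + n - 2 * K.+2%:Z - 2) (Y om K.+2%:Z v) by exact: (wtY HV (K.+2)%:Z (wt_om HV) Hv).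
  apply: (gsum_bind (IH _ _ _ Hw (stab_Yom _ sv))) => [|k x [sx lx kx]].
    by lia.
  by apply: (@gsum1 _ _ _ k); split=> //; lia.
(* t(k) is 1 / ([hwt k] - [hwt n]), defined because k < n; subtracting t(k) y for each component y
   of the remainder makes v' an eigenvector for [hwt n]. *)
pose t (k : int) : C := 2%:R / (k - n)%:~R.
have tE k : k <= n - 1 -> t k * hwt R k - 1 = t k * hwt R n.
  move=> kn; rewrite /t /hwt.
  have k0 : (k - n)%:~R != 0 :> C by rewrite intr_eq0; lia.
  have -> : (k%:~R : C) = (k - n)%:~R + n%:~R by rewrite -rmorphD /= subrK.
  by move: ((k - n)%:~R : C) k0 (n%:~R : C) => d d0 e; field.
pose v' := v - \sum_(y <- l) t y.1 *: y.2.
have -> : v = v' + \sum_(y <- l) t y.1 *: y.2 by rewrite subrK.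
apply: gsumD; last first.
  rewrite big_seq; elim/big_rec: _ => [|y x yl IHx]; first exact: gsum0.
  apply: gsumD => //; apply: (@gsum1 _ _ _ y.1).
  by have [sy ly yn] := zdiagZ (t y.1) (Hl y yl); split=> //; lia.
apply: (@gsum1 _ _ _ n); split=> //.
  rewrite /v' addrC -scaleN1r; apply: stab_lin => //; rewrite big_seq.
  by apply: stab_sum => y yl; apply: stabZ; case: (Hl y yl).
rewrite /v' (linB (Lb_lin HV 0)) E Er (lin_sum (Lb_lin HV 0)) scalerBr -addrA; congr (_ + _).
rewrite -sumrB scaler_sumr -sumrN; apply: eq_big_seq => y yl.
have [_ ly yn] := Hl y yl.
rewrite (linZ (Lb_lin HV 0)) ly !scalerA.
transitivity ((1 - t y.1 * hwt R y.1) *: y.2); first by rewrite scalerBl scale1r.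
rewrite -[RHS]scaleNr; apply: (congr1 (fun a : C => a *: y.2)).
by rewrite [hwt R n * _]mulrC -(tE _ yn); ring.
Qed.

Variable S : V -> fser R.
Hypothesis HS : formal_1pt Y om c sig g h T T1 S.

Lemma Slin mu : lin (fun v => (S v mu : C)). Proof. by move=> a u w; exact: (f_lin HS). Qed.

Lemma S_supp_from v : exists lam, supp_from T lam (S v). Proof. exact: (f_adm HS). Qed.

Let T0 : (0 < T)%N. Proof. by case: gT. Qed.
Let T10 : (0 < T1)%N. Proof. by case: hT. Qed.

Lemma S_lfin v : lfin T (S v).
Proof. by have [lam Hl] := S_supp_from v; exact: (supp_from_lfin T0 Hl). Qed.

Variable B : seq V.
Definition generated a := inspan T (size B) (fun i => S (nth 0 B i)) a.

Let lB i : lfin T (S (nth 0 B i)). Proof. exact: S_lfin. Qed.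

Lemma gen_lin a u w : generated (S u) -> generated (S w) -> generated (S (a *: u + w)).
Proof.
move=> Hu Hw; apply: inspan_ext (inspan_lin lB a Hu Hw) => mu.
by rewrite (f_lin HS).
Qed.

Lemma gen_0 : generated (S 0).
Proof. by apply: inspan_ext (inspan0 _ _ _) => mu; rewrite (lin0 (Slin mu)). Qed.

Lemma gen_Z a u : generated (S u) -> generated (S (a *: u)).
Proof. by move=> H; rewrite -[a *: u]addr0; apply: gen_lin => //; exact: gen_0. Qed.

Lemma gen_sum (I : Type) (s : seq I) (P : pred I) (G : I -> V) :
  (forall i, P i -> generated (S (G i))) -> generated (S (\sum_(i <- s | P i) G i)).
Proof.
move=> H; elim/big_rec: _ => [|i v Pi IH]; first exact: gen_0.
by rewrite -[G i]scale1r; apply: gen_lin => //; exact: H.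
Qed.

Lemma gen_zhu u a m w : (forall i : nat, generated (S (Y u (m + i%:Z) w))) -> generated (S (zhu u a m w)).
Proof.
move=> H; have [K HK] := Y_vanish HV u w m; rewrite (zhuE HV a HK).
by apply: gen_sum => i _; apply: gen_Z.
Qed.

Lemma gen_lead u a m w : generated (S (zhu u a m w)) -> (forall i : nat, generated (S (Y u (m + i.+1%:Z) w))) ->
  generated (S (Y u m w)).
Proof.
move=> Hz H; have [K E] := zhu_lead HV u a m w.
have -> : Y u m w = -1 *: (\sum_(i < K) zcoef a (m + i.+1%:Z) m *: Y u (m + i.+1%:Z) w) + zhu u a m w.
  by rewrite E scaleN1r addrCA addNr addr0.
by apply: gen_lin => //; apply: gen_sum => i _; apply: gen_Z.
Qed.

Lemma fmul_Q0 j (lam : C) (a : fser R) (mu : C) : fmul T (Qcoef T j lam 0) a mu = - a mu.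
Proof.
rewrite /fmul (@csum_fin _ _ 1) => [|r r0].
  by rewrite big_ord1 /= mulN1r mul0r subr0.
by rewrite /Qcoef eqn0Ngt r0 oppr0 mul0r.
Qed.

(* For an untwisted [u], [u[-2]w] is reduced by the [E_{2k}]-relation; for a twisted one,
   [u(-2)w = (L(-1)u)(-1)w] is reduced by the [Q_k]-relation, whose leading coefficient is
   [Q_0 = -1]. *)
Lemma gen_C2 n p q u w : (forall k v, k < n -> wt k v -> generated (S v)) -> wt p u -> wt q w ->
  p + q + 2 = n -> generated (S (Y u (-2) w)).
Proof.
move=> IH Hu Hw pq.
have [l [-> Hl]] := gsum_eigP Hu; rewrite (lin_sum (Ylin HV _ _)) big_seq.
apply: gen_sum => y yl; have [yp [Hy [j [lam He]]]] := Hl y yl.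
rewrite yp in Hy He; move: y.2 Hy He => {Hl Hu yl yp}u Hu He.
have [[j0 lam1]|nt] := pselect (j = 0%N /\ lam = 1).
  subst j lam; have [K HK] := zhu_vanish HV u (hwt R p) w.
  have [_ /(_ K HK) E] := f_O1 HS w He.
  have low i : generated (S (Y u (-2 + i.+1%:Z) w)).
    by apply: (IH _ _ _ (wtY HV _ Hu Hw)); lia.
  apply: (@gen_lead u (hwt R p) (-2) w _ low).
  apply: (@inspan_ext _ _ _ _ (fun mu => \sum_(2 <= k < K) (- (2 * k).-1%:R) *
    fmul T (ecoefT R T k) (S (zhu u (hwt R p) ((2 * k).-2)%:Z w)) mu)) => [mu|].
    move/(canRL (addrK _)): (E mu); rewrite sub0r => ->.
    by rewrite -sumrN; apply: eq_bigr => k _; rewrite mulNr.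
  apply: (inspan_sum lB) => k _; apply: (inspanZ lB); apply: (inspan_fmul lB).
    exact: subexp_ecoefT.
  apply: gen_zhu => i; apply: (IH _ _ _ (wtY HV _ Hu Hw)); lia.
have [HL Hpar jT HgE [lamT HhE]] := He.
(* This is L(-1)u: its weight is one higher, and its g- and h-eigenvalues are those of [u] because
   both automorphisms fix [om]. *)
pose u' := Y om 0 u.
have Hu' : wt (p + 2) u' by have := wtY HV 0 (wt_om HV) Hu; congr (wt _ _); lia.
have [_ _ gY _ gom] := Hg; have [_ _ hY _ hom] := Hh.
have He' : eigen u' (hwt R (p + 2)) (odd `|(p + 2)%R|%N) j lam.
  split=> //; first exact: (wt_par HV Hu').
    by rewrite /u' gY gom HgE (linZ (Ylinr HV _ _)).
  by split=> //; rewrite /u' hY hom HhE (linZ (Ylinr HV _ _)).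
have -> : Y u (-2) w = Y u' (-1) w.
  by rewrite /u' (Y_deriv HV) opprK scale1r.
have [K HK] := zhu_vanish HV u' (hwt R (p + 2)) w.
have E := f_O3 HS He' nt HK.
have low (i : nat) : generated (S (Y u' i%:Z w)).
  by apply: (IH _ _ _ (wtY HV _ Hu' Hw)); lia.
apply: (@gen_lead u' (hwt R (p + 2))) => [|i]; last first.
  by have := low i; congr (generated (S (Y u' _ w))); lia.
apply: (@inspan_ext _ _ _ _ (fun mu => \sum_(k < K)
    fmul T (Qcoef T j lam k.+1) (S (zhu u' (hwt R (p + 2)) (k.+1%:Z - 1) w)) mu)) => [mu|].
  have H := E mu; rewrite big_ord_recl fmul_Q0 in H.
  move/eqP: H; rewrite addrC subr_eq0 => /eqP H.
  rewrite -[RHS]/(S (zhu u' (hwt R (p + 2)) ((ord0 : 'I_K.+1)%:Z - 1) w) mu) -H.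
  by apply: eq_bigr => k _; rewrite lift0.
apply: (inspan_sum lB) => k _; apply: (inspan_fmul lB).
  exact: (subexp_Qcoef T0 jT T10 lamT).
apply: gen_zhu => i; have := low (k + i)%N; congr (generated (S (Y u' _ w))); lia.
Qed.

End Reduction.

(** * Finite generation, the differential system and the growth of coefficients *)

Section Convergence.
Variable R : realType.
Local Notation C := (CC R).
Variables (V : lmodType C) (Y : V -> int -> V -> V) (vac om : V) (c : C) (sig : V -> V).
Hypothesis HV : is_vosa Y vac om c sig.
Hypothesis HC2 : C2_cofinite Y.
Variables (g h : V -> V) (T T1 : nat).
Hypotheses (Hg : is_aut Y vac om g) (Hh : is_aut Y vac om h).
Hypotheses (gT : has_order g T) (hT : has_order h T1) (gh : forall v, g (h v) = h (g v)).
Variable S : V -> fser R.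
Hypothesis HS : formal_1pt Y om c sig g h T T1 S.

Local Notation L0 := (L0 Y om).
Local Notation zhu := (zhu Y).
Local Notation Lb := (Lb Y om c).
Local Notation wt := (wt Y om).
Local Notation eigen := (eigen Y om sig g h T T1).
Local Notation generated := (generated T S).
Local Notation supp_from := (supp_from T).
Local Notation cseq := (cseq T).

Let T0 : (0 < T)%N. Proof. by case: gT. Qed.
Let T10 : (0 < T1)%N. Proof. by case: hT. Qed.

Definition C2P (N k : int) (v : V) := wt k v /\
  (k <= N \/ exists u w p q, [/\ wt p u, wt q w & v = Y u (-2) w]).

Lemma C2PZ N k a v : C2P N k v -> C2P N k (a *: v).
Proof.
move=> [Hv H]; split; first exact: (wtZ HV).
case: H => [|[u [w [p [q [Hu Hw ->]]]]]]; first by left.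
right; exists (a *: u), w, p, q; split=> //; first exact: (wtZ HV).
by rewrite (linZ (Ylin HV _ _)).
Qed.

Lemma gsum_bounded_wt (s : seq V) :
  exists N : int, forall v, v \in s -> gsum (fun k x => wt k x /\ k <= N) v.
Proof.
elim: s => [|v s [N HN]]; first by exists 0.
have [l [E Hl]] := gsum_wt HV v.
have [M HM] : exists M : int, forall y, y \in l -> y.1 <= M.
  elim: l {E Hl} => [|y l [M HM]]; first by exists 0.
  exists (Num.max M y.1) => x; rewrite inE le_max => /orP[/eqP ->|/HM ->] //.
  by rewrite lexx orbT.
exists (Num.max M N) => x; rewrite inE => /orP[/eqP ->|/HN H].
  by exists l; split=> // y yl; split; [exact: Hl | rewrite le_max HM].
apply: (gsum_bind H) => k y [Hy ky]; apply: (@gsum1 _ _ _ k); split=> //.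
by rewrite le_max ky orbT.
Qed.

(** [N] bounds the weights occurring in a finite set that spans V modulo C_2. The vectors u(-2)w
    split further by decomposing [u] and [w] into homogeneous parts. *)
Lemma C2_gsum : exists N, forall x, gsum (C2P N) x.
Proof.
have [s Hs] := HC2; have [N HN] := gsum_bounded_wt s; exists N => x.
have [a [t ->]] := Hs x; apply: gsumD.
  apply: gsum_sum => i; apply: gsumZ => [k v|]; first exact: C2PZ.
  apply: (gsum_bind (HN _ (mem_nth 0 (ltn_ord i)))) => k v [Hv kN].
  by apply: (@gsum1 _ _ _ k); split=> //; left.
apply: gsum_sum => -[u w] /=.
have [lu [-> Hlu]] := gsum_wt HV u; have [lw [-> Hlw]] := gsum_wt HV w.
rewrite (lin_sum (Ylin HV _ _)) big_seq.
elim/big_rec: _ => [|y v yl IH]; first exact: gsum0.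
apply: gsumD => //; rewrite (lin_sum (Ylinr HV _ _)) big_seq.
elim/big_rec: _ => [|y' v' yl' IH']; first exact: gsum0.
apply: gsumD => //; apply: (@gsum1 _ _ _ (y.1 + y'.1 - 2 * -2 - 2)).
split; first exact: (wtY HV (-2) (Hlu y yl) (Hlw y' yl')).
right; exists y.2, y'.2, y.1, y'.1; split=> //; [exact: Hlu | exact: Hlw].
Qed.

Definition lspan (B : seq V) (v : V) := exists (a : nat -> C) (s : seq V),
  v = \sum_(i < size s) a i *: s`_i /\ {subset s <= B}.

(** Weights are bounded below and each weight space is finite-dimensional, so only finitely many
    spanning sets need to be concatenated. *)
Lemma low_weight_span (N : int) :
  exists B : seq V, forall n v, n <= N -> wt n v -> lspan B v.
Proof.
have [n0 Hn0] := L0_bounded HV.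
suff H (m : nat) : exists B : seq V, forall n v, n < n0 + m%:Z -> wt n v -> lspan B v.
  have [B HB] := H (`|N - n0|%N.+1); exists B => n v nN; apply: HB; lia.
elim: m => [|m [B HB]].
  exists [::] => n v nn Hv; exists (fun=> 0), [::]; rewrite big_ord0; split=> //.
  by apply: (Hn0 n v) => //; lia.
have [s Hs] := L0_findim HV (n0 + m%:Z).
exists (B ++ s) => n v nn Hv.
have [nm|nm] := ltP n (n0 + m%:Z).
  have [a [t [E Ht]]] := HB n v nm Hv; exists a, t; split=> // y /Ht yB.
  by rewrite mem_cat yB.
have nE : n = n0 + m%:Z by lia.
rewrite nE in Hv; have [a E] := Hs v Hv; exists a, s; split=> // y ys.
by rewrite mem_cat ys orbT.
Qed.

Lemma all_generated : exists B, forall v, generated B (S v).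
Proof.
have [N HN] := C2_gsum; have [B HB] := low_weight_span N; exists B => v.
have lB i : lfin T (S (nth 0 B i)) by exact: (S_lfin gT HS).
have [n0 Hn0] := L0_bounded HV.
suff key (m : nat) : forall n v, n < n0 + m%:Z -> wt n v -> generated B (S v).
  have [l [-> Hl]] := gsum_wt HV v; rewrite big_seq; apply: (gen_sum gT HS) => y yl.
  apply: (key `|y.1 - n0|%N.+1 y.1 _ _ (Hl y yl)); lia.
elim: m => [|m IH] {}n {}v nm Hv.
  rewrite (Hn0 n v) //; first exact: (gen_0 HS _).
  by rewrite addr0 in nm.
have [nN|nN] := leP n N.
  have [a [t [-> Ht]]] := HB n v nN Hv; apply: (gen_sum gT HS) => i _.
  apply: (gen_Z gT HS); have yB := Ht _ (mem_nth 0 (ltn_ord i)); rewrite -(nth_index 0 yB).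
  by apply: inspan_gen; rewrite index_mem.
have [l [E Hl]] := HN v.
(* The decomposition of [v] may contain parts of other weights, even higher ones; only the parts of
   weight [n] are kept. *)
rewrite (wt_component HV (fun y yl => (Hl y yl).1) Hv E) big_seq_cond.
apply: (gen_sum gT HS) => y /andP[yl /eqP yn].
have [Hy [yN|[u [w [p [q [Hu Hw yE]]]]]]] := Hl y yl.
  by move: nN; rewrite ltNge -yn yN.
have := wtY HV (-2) Hu Hw; rewrite -yE => Hy'.
(* If the label differs from the actual weight of u(-2)w, the vector has two weights and is zero. *)
have [pq|pq] := eqVneq (p + q - 2 * -2 - 2) y.1.
  rewrite yE; apply: (gen_C2 HV Hg Hh gT hT gh HS _ Hu Hw (n := n)); last by rewrite -yn -pq; ring.
  by move=> k x kn; apply: IH; lia.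
by rewrite (wt_uniq Hy' Hy pq); exact: (gen_0 HS _).
Qed.

(** By linearity it suffices to treat joint eigenvectors. Either S vanishes on them, or they are
    fixed by sigma, g and h and split into L[0]-eigenvectors, for which the L[-2] identity is solved
    for the derivative. *)
Lemma fder_generated B v : (forall x, generated B (S x)) -> generated B (fder (S v)).
Proof.
move=> HB.
have lB i : lfin T (S (nth 0 B i)) by exact: (S_lfin gT HS).
have gen_fsum (P : int -> V -> Prop) x : gsum P x -> (forall n y, P n y -> generated B (fder (S y))) ->
    generated B (fder (S x)).
  move=> [l [-> Hl]] H.
  apply: (@inspan_ext _ _ _ _ (fun mu => \sum_(y <- l | y \in l) fder (S y.2) mu)) => [mu|].
    by rewrite -big_seq /fder (lin_sum (Slin HS mu)) mulr_sumr.
  by apply: (inspan_sum lB) => y yl; exact: H (Hl y yl).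
apply: (gen_fsum _ v (gsum_eig HV Hg Hh gT hT gh v)) => n x [Hx [j [lam He]]].
have [[nb [j0 lam1]]|nt] := pselect (odd `|n|%N = false /\ j = 0%N /\ lam = 1); last first.
  apply: inspan_ext (inspan0 _ _ _) => mu.
  by rewrite /fder (f_O2 HS He nt) mulr0.
have st : stab sig g h x.
  case: He => _; rewrite /par nb expr0 scale1r => sx _ gx [_ hx]; split=> //.
    by rewrite gx j0 /rootT mulr0 mul0r cexp0 invr1 scale1r.
  by rewrite hx lam1 invr1 scale1r.
apply: (gen_fsum _ x (gsum_zdiag HV Hg Hh Hx st)) => k y [[sy gy hy] ly kn].
have [K HK] : exists K : nat, forall l : nat, (2 <= l)%N -> (K <= l)%N -> Lb ((2 * l).-2)%:Z y = 0.
  have [K HK] := zhu_vanish HV om 2%:R y; exists K => l l2 Kl.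
  have e : ((2 * l).-2)%:Z + 1 = ((2 * l).-1)%:Z by lia.
  rewrite /Defs.Lb e (HK (2 * l).-1); last by lia.
  by case: eqP => [//|_]; rewrite scale0r subrr.
have E := f_L HS sy gy hy ly HK.
apply: (@inspan_ext _ _ _ _ (fun mu => (-1) * (hwt R k * fmul T (ecoefT R T 1) (S y) mu) +
   ((-1) * (\sum_(2 <= l < K) fmul T (ecoefT R T l) (S (Lb ((2 * l).-2)%:Z y)) mu)
    + S (Lb (-2) y) mu))) => [mu|].
  by rewrite (E mu); ring.
apply: (inspan_lin lB).
  apply: (inspanZ lB); apply: (inspan_fmul lB); [exact: subexp_ecoefT | exact: HB].
apply: (inspan_lin lB); last exact: HB.
apply: (inspan_sum lB) => l _.
by apply: (inspan_fmul lB); [exact: subexp_ecoefT | exact: HB].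
Qed.

(** One of S(v), S(w), S(v+w) is nonzero at both exponents: when S(w) vanishes at [mu] and S(v) at
    [mu'], nothing cancels in S(v+w). *)
Lemma comparable_support v w mu mu' : S v mu != 0 -> S w mu' != 0 ->
  exists m n : nat, mu + m%:R / T%:R = mu' + n%:R / T%:R.
Proof.
move=> Hv Hw.
have cmp x : S x mu != 0 -> S x mu' != 0 ->
    exists m n : nat, mu + m%:R / T%:R = mu' + n%:R / T%:R.
  have [lam Hl] := S_supp_from HS x => /Hl[n ->] /Hl[n' ->].
  by exists n', n; rewrite -!addrA [_ / _ + _]addrC.
have [a|a] := eqVneq (S w mu) 0; last exact: (cmp w).
have [b|b] := eqVneq (S v mu') 0; last exact: (cmp v).
apply: (cmp (1 *: v + w)); rewrite (f_lin HS) mul1r.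
  by rewrite a addr0.
by rewrite b add0r.
Qed.

(* The exponents of all the [S v] lie in one class modulo [Z/T]: otherwise some [S (v + w)]
   would have its support in two classes. *)
Lemma common_supp_from (s : seq V) : exists lam, forall v, v \in s -> supp_from lam (S v).
Proof.
elim: s => [|v s [lam Hl]]; first by exists 0.
have [lam' Hl'] := S_supp_from HS v.
have [[mu Hmu]|Z] := pselect (exists mu, S v mu != 0); last first.
  exists lam => x; rewrite inE => /orP[/eqP -> mu Hmu|]; last exact: Hl.
  by case: Z; exists mu.
have [[w [ws [mu' Hmu']]]|Z] := pselect (exists w, w \in s /\ exists mu, S w mu != 0); last first.
  exists lam' => x; rewrite inE => /orP[/eqP -> //|xs] mu' Hmu'.
  by case: Z; exists x; split=> //; exists mu'.
have [m [n E]] := comparable_support Hmu Hmu'.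
have [k Ek] := Hl' _ Hmu; have [k' Ek'] := Hl _ ws _ Hmu'.
have e : lam' - (k' + n)%:R / T%:R = lam - (k + m)%:R / T%:R.
  move: E; rewrite Ek Ek' !natrD !mulrDl => E.
  apply/eqP; rewrite subr_eq; apply/eqP.
  rewrite -[LHS](addrK (k%:R / T%:R + m%:R / T%:R)) [lam' + _]addrA E; ring.
exists (lam - (k + m)%:R / T%:R) => x; rewrite inE => /orP[/eqP ->|xs].
  by rewrite -e; exact: supp_from_shift.
by apply: supp_from_shift; exact: Hl.
Qed.

Lemma subexp_supp_from lam lam' (a : fser R) : supp_from lam a -> supp_from lam' a ->
  subexp (cseq lam a) -> subexp (cseq lam' a).
Proof.
move=> ga ga' Ha; have [[mu amu]|H] := pselect (exists mu, a mu != 0); last first.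
  apply: subexp_le (subexp_delta 0) => n.
  have -> : cseq lam' a n = 0 by apply/eqP; apply: contraT => h'; case: H; eexists; exact: h'.
  by rewrite cabs0 cabs_ge0.
have [n En] := ga _ amu; have [n' En'] := ga' _ amu.
have [nn|/ltnW nn] := leqP n n'.
  have -> : lam' = lam - (n' - n)%:R / T%:R.
    by apply: (addIr (n'%:R / T%:R)); rewrite -En' En natrB // mulrBl; ring.
  (* [ev_shift] speaks of a point of the upper half-plane; the growth statement extracted from it
     does not depend on the point, so i is used. *)
  have t0 : 0 < cIm (cmk 0 1 : C) by rewrite /= ltr01.
  exact: (ev_shift T0 (n' - n) ga Ha t0).1.
have -> : lam' = lam + (n - n')%:R / T%:R.
  by apply: (addIr (n'%:R / T%:R)); rewrite -En' En natrB // mulrBl; ring.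
move: (n - n')%N => k; elim: k => [|k IH]; first by rewrite mul0r addr0.
apply: subexp_le (rsubexp_shift (fun n => cabs_ge0 _) IH) => i.
have -> // : cseq (lam + k.+1%:R / T%:R) a i = cseq (lam + k%:R / T%:R) a i.+1.
by rewrite /cseq -!addrA -!mulrDl -!natrD addSnnS.
Qed.

Lemma S_subexp v lam : supp_from lam (S v) -> subexp (cseq lam (S v)).
Proof.
move=> gv; have [B HB] := all_generated; have [lam' Hl] := common_supp_from (v :: B).
have gv' : supp_from lam' (S v) by apply: Hl; rewrite mem_head.
apply: (subexp_supp_from gv' gv).
have gB i : supp_from lam' (S (nth 0 B i)).
  have [iB|iB] := ltnP i (size B); first by apply: Hl; rewrite inE mem_nth ?orbT.
  (* Indices beyond the list return the default vector 0, where S vanishes. *)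
  by rewrite nth_default // => mu; rewrite (lin0 (Slin HS mu)) eqxx.
have [f Hf] := choice (fun i => fder_generated (nth 0 B i) HB).
have HSB := ode_subexp T0 gB (fun i => (Hf i).1) (fun i mu _ => (Hf i).2 mu).
have [k [Hk E]] := HB v.
apply: (@subexp_le _ _ (fun n => \sum_(i < size B) cseq lam' (fmul T (k i) (S (nth 0 B i))) n)) => [n|].
  by rewrite /cseq E.
have Hi i : (i < size B)%N -> subexp (cseq lam' (fmul T (k i) (S (nth 0 B i)))).
  by move=> iB; exact: (subexp_cseq_fmul T0 (gB i) (Hk i) (HSB i iB)).
elim: (size B) Hi => [|m IH] Hi.
  by apply: subexp_le (subexp_delta 0) => n; rewrite big_ord0 cabs0 cabs_ge0.
apply: subexp_le (subexpD (IH (fun i im => Hi i (ltnW im))) (Hi m (ltnSn m))) => n.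
by rewrite big_ord_recr.
Qed.

End Convergence.

(** * Transfer of formal identities to functions of tau *)

Section Representation.
Variable R : realType.
Local Notation C := (CC R).
Variable T : nat.
Hypothesis T0 : (0 < T)%N.
Variables (lam tau : C).
Hypothesis tau0 : 0 < cIm tau.

(** Bundles support, growth and value at [tau] relative to one base. The value of each side of a
    formal identity is built compositionally, and [has_value_uniq] equates the results. *)
Definition has_value (a : fser R) (x : C) :=
  [/\ supp_from T lam a, subexp (cseq T lam a) & ev T lam a tau = x].

Lemma has_value_uniq a b x y : has_value a x -> has_value b y -> a =1 b -> x = y.
Proof.
move=> [_ _ <-] [_ _ <-] E; rewrite /ev; congr (_ * _).
by apply: eq_psum => n; rewrite /cseq E.
Qed.

Lemma has_value_lin (c : C) a b e x y : (forall mu, e mu = c * a mu + b mu) ->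
  has_value a x -> has_value b y -> has_value e (c * x + y).
Proof.
move=> E [ga Ha Ea] [gb Hb Eb]; split.
- exact: (supp_from_lin E ga gb).
- by apply: (@subexp_le _ _ (fun n => c * cseq T lam a n + cseq T lam b n)) => [n|];
    [rewrite /cseq E | exact: (subexpD (subexpZ c Ha) Hb)].
- by rewrite (ev_lin T0 E Ha Hb tau0) Ea Eb.
Qed.

Lemma has_value0 a : (forall mu, a mu = 0) -> has_value a 0.
Proof.
move=> Z; split=> [mu||]; first by rewrite Z eqxx.
  by apply: subexp_le (subexp_delta 0) => n; rewrite /cseq Z cabs0 cabs_ge0.
rewrite /ev (eq_psum (b := delta 0)) ?psum_delta ?mulr0 // => n.
by rewrite /cseq Z /delta mulr0.
Qed.

Lemma has_value_fmul f a x : subexp f -> has_value a x ->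
  has_value (fmul T f a) (psum f (qpow (T%:R^-1) tau) * x).
Proof.
move=> Hf [ga Ha <-]; split.
- exact: supp_from_fmul.
- exact: (subexp_cseq_fmul T0 ga Hf Ha).
- exact: (ev_fmul T0 ga Hf Ha tau0).
Qed.

Lemma has_value_sum (s : seq nat) (F : nat -> fser R) (x : nat -> C) :
  (forall k, k \in s -> has_value (F k) (x k)) ->
  has_value (fun mu => \sum_(k <- s) F k mu) (\sum_(k <- s) x k).
Proof.
elim: s => [|k s IH] H; first by rewrite big_nil; apply: has_value0 => mu; rewrite big_nil.
rewrite big_cons -[x k]mul1r; apply: (has_value_lin (a := F k) (b := fun mu => \sum_(k <- s) F k mu)).
- by move=> mu; rewrite big_cons mul1r.
- by apply: H; rewrite mem_head.
- by apply: IH => j js; apply: H; rewrite inE js orbT.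
Qed.

Lemma has_valueZ (c : C) a x : has_value a x -> has_value (fun mu => c * a mu) (c * x).
Proof.
move=> H; rewrite -[c * x]addr0; apply: (has_value_lin _ H (has_value0 (a := fun=> 0) _)) => // mu.
by rewrite addr0.
Qed.

Lemma subexp_cseq_fder a : subexp (cseq T lam a) -> subexp (cseq T lam (fder a)).
Proof.
move=> Ha; pose u n := lam * cseq T lam a n + T%:R^-1 * shiftr1 (dseq (cseq T lam a)) n.
apply: (@subexp_le _ _ u) => [n|].
  suff -> : cseq T lam (fder a) n = u n by [].
  rewrite /u /cseq /fder; case: n => [|n] /=; first by rewrite mul0r mulr0 !addr0.
  by rewrite /dseq mulrDl mulrA [_^-1 * _]mulrC.
exact: (subexpD (subexpZ _ Ha) (subexpZ _ (subexp_shiftr1 (subexp_dseq Ha)))).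
Qed.

Lemma supp_from_fder a : supp_from T lam a -> supp_from T lam (fder a).
Proof.
move=> ga mu; rewrite /fder; have [->|/ga //] := eqVneq (a mu) 0.
by rewrite mulr0 eqxx.
Qed.

End Representation.

Lemma twopii_neq0 (R : realType) : twopii R != 0.
Proof.
rewrite -cabs_eq0 gt_eqF // (lt_le_trans _ (cabs_geIm _)) //= ger0_norm.
  by rewrite mulr_gt0 // pi_gt0.
by rewrite mulr_ge0 // pi_ge0.
Qed.

Unset Implicit Arguments.

Theorem theorem5p5 (R : realType) (V : lmodType (CC R))
  (Y : V -> int -> V -> V) (vac om : V) (c : CC R) (sig : V -> V)
  (g h : V -> V) (T T1 : nat) (S : V -> fser R) :
  is_vosa Y vac om c sig ->
  C2_cofinite Y ->
  is_aut Y vac om g -> is_aut Y vac om h ->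
  has_order g T -> has_order h T1 ->
  (forall v, g (h v) = h (g v)) ->
  formal_1pt Y om c sig g h T T1 S ->
  exists F : V -> CC R -> CC R,
    in_Cgh Y om c sig g h T T1 F /\
    forall (v : V) (lam : CC R),
      (forall mu : CC R, S v mu != 0 -> exists n : nat, mu = lam + n%:R / T%:R) ->
      forall tau : CC R, 0 < cIm tau ->
        series (fun n : nat => S v (lam + n%:R / T%:R) * qpow (lam + n%:R / T%:R) tau) @ \oo
          --> F v tau.
Proof.
move=> HV HC2 Hg Hh gT hT gh HS.
have [T0 _ _] := gT; have [T10 _ _] := hT.
have Hsub := S_subexp HV HC2 Hg Hh gT hT gh HS.
(* A base exponent is chosen for each [v]; [FE] shows that the resulting value does not depend on
   it. *)
have [lamv Hv] := choice (fun v => f_adm HS v).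
pose F v tau := ev T (lamv v) (S v) tau.
have FE v lam tau : 0 < cIm tau -> supp_from T lam (S v) -> has_value T lam tau (S v) (F v tau).
  move=> t0 gv; split=> //; first exact: Hsub.
  exact: (ev_indep T0 gv (Hv v) (Hsub _ _ gv) (Hsub _ _ (Hv v)) t0).
have DF v tau : 0 < cIm tau ->
    is_derive tau 1 (F v) (twopii R * ev T (lamv v) (fder (S v)) tau).
  by move=> t0; exact: (is_derive_ev T0 (Hv v) (Hsub _ _ (Hv v)) t0).
have FD v lam tau : 0 < cIm tau -> supp_from T lam (S v) ->
    has_value T lam tau (fder (S v)) ((twopii R)^-1 * derive1 (F v) tau).
  move=> t0 gv; split; first exact: supp_from_fder.
    by apply: subexp_cseq_fder; exact: Hsub.
  (* After division by 2 pi i, d/dtau multiplies q^mu by mu, which is the action of [fder]. *)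
  have := DF v tau t0; case=> _ dE; rewrite derive1E dE mulKf ?twopii_neq0 //.
  apply: (ev_indep T0 (supp_from_fder gv) (supp_from_fder (Hv v)) _ _ t0).
    by apply: subexp_cseq_fder; exact: Hsub.
  by apply: subexp_cseq_fder; exact: (Hsub _ _ (Hv v)).
exists F; split; last first.
  move=> v lam gv tau t0; have [_ _ <-] := FE v lam tau t0 gv.
  exact: (ev_cvg T0 (Hsub _ _ gv) t0).
split.
- by move=> v tau t0; have := DF v tau t0; case.
- move=> a u w tau t0.
  (* Values can be added only relative to one base, so all vectors of the identity are given a
     common one. The other clauses with several vectors proceed in the same way. *)
  have [lam Hl] := common_supp_from HS [:: u; w; a *: u + w].
  have gu : supp_from T lam (S u) by apply: Hl; rewrite !inE eqxx.
  have gw : supp_from T lam (S w) by apply: Hl; rewrite !inE eqxx !orbT.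
  have gs : supp_from T lam (S (a *: u + w)) by apply: Hl; rewrite !inE eqxx !orbT.
  exact: (has_value_uniq (FE _ _ _ t0 gs) (has_value_lin T0 t0 (f_lin HS a u w) (FE _ _ _ t0 gu) (FE _ _ _ t0 gw))
    (fun=> erefl)).
- move=> v a b w tau t0 He; have [Z E] := f_O1 HS w He; split.
    exact: (has_value_uniq (FE _ _ _ t0 (Hv _)) (has_value0 T (lamv (zhu Y v a 0 w)) tau Z) (fun=> erefl)).
  move=> K HK; have {}E := E K HK.
  pose x := zhu Y v a (-2) w; pose y k := zhu Y v a ((2 * k).-2)%:Z w.
  have [lam Hl] := common_supp_from HS (x :: [seq y k | k <- index_iota 2 K]).
  have gx : supp_from T lam (S x) by apply: Hl; rewrite mem_head.
  have gy k : k \in index_iota 2 K -> supp_from T lam (S (y k)).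
    by move=> kK; apply: Hl; rewrite inE map_f ?orbT.
  have H := has_value_sum T0 t0 (fun k (kK : k \in index_iota 2 K) => has_valueZ T0 t0 (2 * k).-1%:R
    (has_value_fmul T0 t0 (subexp_ecoefT T k) (FE _ _ _ t0 (gy k kK)))).
  have H2 := has_value_lin T0 t0 (fun=> erefl) (FE _ _ _ t0 gx) H.
  rewrite -[RHS](has_value_uniq (H2 1) (has_value0 T lam tau (a := fun=> 0) (fun=> erefl))) => [|mu].
    rewrite mul1r; congr (_ + _); apply: eq_bigr => k _.
    by rewrite (Efun_psum T0 t0) mulrA.
  by rewrite mul1r; exact: E.
- move=> v a b j lam tau t0 He nt; have Z := f_O2 HS He nt.
  exact: (has_value_uniq (FE _ _ _ t0 (Hv _)) (has_value0 T (lamv v) tau Z) (fun=> erefl)).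
- move=> v a b j lam w tau t0 He nt K HK; have E := f_O3 HS He nt HK.
  have [_ _ jT _ [lamT _]] := He.
  pose y (k : nat) := zhu Y v a (k%:Z - 1) w.
  have [l Hl] := common_supp_from HS [seq y k | k <- index_iota 0 K.+1].
  have gy k : k \in index_iota 0 K.+1 -> supp_from T l (S (y k)).
    by move=> kK; apply: Hl; rewrite map_f.
  have H := has_value_sum T0 t0 (fun k (kK : k \in index_iota 0 K.+1) =>
    has_value_fmul T0 t0 (subexp_Qcoef T0 jT T10 lamT k) (FE _ _ _ t0 (gy k kK))).
  rewrite -[RHS](has_value_uniq H (has_value0 T l tau (a := fun=> 0) (fun=> erefl))) => [|mu].
    by rewrite big_mkord; apply: eq_bigr => k _; rewrite (Qfun_psum T0 t0 jT T10 lamT).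
  by rewrite big_mkord; exact: E.
- move=> v k tau t0 sv gv hv lv K HK; have E := f_L HS sv gv hv lv HK.
  pose x := Lb Y om c (-2) v; pose y l := Lb Y om c ((2 * l).-2)%:Z v.
  have [lam Hl] := common_supp_from HS (x :: v :: [seq y l | l <- index_iota 2 K]).
  have gx : supp_from T lam (S x) by apply: Hl; rewrite mem_head.
  have gv' : supp_from T lam (S v) by apply: Hl; rewrite !inE eqxx orbT.
  have gy l : l \in index_iota 2 K -> supp_from T lam (S (y l)).
    by move=> lK; apply: Hl; rewrite !inE map_f ?orbT.
  have H := has_value_sum T0 t0 (fun l (lK : l \in index_iota 2 K) =>
    has_value_fmul T0 t0 (subexp_ecoefT T l) (FE _ _ _ t0 (gy l lK))).
  have H1 := has_value_lin T0 t0 (c := k) (fun=> erefl)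
    (has_value_fmul T0 t0 (subexp_ecoefT T 1) (FE _ _ _ t0 gv')) H.
  have H2 := has_value_lin T0 t0 (c := 1) (fun=> erefl) (FD v lam tau t0 gv') H1.
  rewrite (has_value_uniq (FE _ _ _ t0 gx) H2) => [|mu]; last by rewrite (E mu) mul1r addrA.
  rewrite mul1r (Efun_psum T0 t0) addrA mulrA; congr (_ + _).
  by apply: eq_bigr => l _; rewrite (Efun_psum T0 t0).
Qed.
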